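(* The $G_2$-Laplacian $\varphi\mapsto\Delta_\varphi\varphi$ is an orientation-preserving bijection of the space of positive $SU(4)$-invariant 3-forms on $S^7=SU(4)/SU(3)$ onto itself, and its set of fixed points is the union of exactly two circles: there are unique $a_0,R_0>0$ such that the fixed points are precisely the forms $\sigma^3a_0^3\,e^1\wedge\omega+R_0^3\cos(\alpha)V_R+R_0^3\sin(\alpha)V_I$ with $\sigma\in\{-1,1\}$, $\alpha\in\mathbb{R}$.
   Context: $SU(3)$ is embedded in $SU(4)$ as the lower-right $3\times3$ block. Let $\xi_1,\xi_2,\xi_3$ be the standard basis of $\mathbb{C}^3$ and $\mathfrak{m}\subset\mathfrak{su}(4)$ spanned by $e_1=\begin{pmatrix}3i&0\\0&-iI_3\end{pmatrix}$, $e_{2j}=\begin{pmatrix}0&-\xi_j^T\\ \xi_j&0\end{pmatrix}$, $e_{2j+1}=\begin{pmatrix}0&i\xi_j^T\\ i\xi_j&0\end{pmatrix}$ ($j=1,2,3$), with dual basis $e^1,\dots,e^7$; $SU(4)$-invariant forms on $S^7$ are identified with $\mathrm{Ad}(SU(3))$-invariant elements of $\Lambda^\bullet\mathfrak{m}^*$. $\omega=e^{23}+e^{45}+e^{67}$, $V_R=e^{246}-e^{257}-e^{347}-e^{356}$, $V_I=e^{346}-e^{357}+e^{247}+e^{256}$. A 3-form $\varphi$ on a 7-dimensional space is positive if there exist a positive definite inner product $g$ and a volume form $\mathrm{dvol}_g$ of $g$ (for one of the two orientations) with $\frac16\iota_X\varphi\wedge\iota_Y\varphi\wedge\varphi=g(X,Y)\mathrm{dvol}_g$;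 this determines $g_\varphi$ and an orientation. $\Delta_\varphi=*_\varphi d*_\varphi d-d*_\varphi d*_\varphi$ is the Hodge Laplacian on 3-forms for $g_\varphi$ and the induced orientation. Orientation-preserving means $\Delta_\varphi\varphi$ induces the same orientation as $\varphi$; a fixed point is $\varphi$ with $\Delta_\varphi\varphi=\varphi$. *)

(* Defs.v *)
From HB Require Import structures.
From mathcomp Require Import all_boot all_order all_fingroup all_algebra.
From mathcomp Require Import all_classical all_reals all_analysis.
From mathcomp.real_closed Require Import complex.

Set Implicit Arguments.
Unset Strict Implicit.
Unset Printing Implicit Defensive.
Import Order.TTheory GRing.Theory Num.Theory.
Local Open Scope ring_scope.
Local Open Scope classical_set_scope.

Section G2Lap.
Variable R : realType.

(* Coordinates w.r.t. the basis e_1..e_7 of m (0-based: index t <-> e_{t+1}). *)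
Definition V := 'rV[R]_7.

Definition kform (k : nat) := ('I_k -> V) -> R.

Definition is_form (k : nat) (phi : kform k) : Prop :=
  (forall (X : 'I_k -> V) (i : 'I_k) (a : R) (u v : V),
     phi (fun t => if t == i then a *: u + v else X t)
     = a * phi (fun t => if t == i then u else X t)
       + phi (fun t => if t == i then v else X t)) /\
  (forall (X : 'I_k -> V) (i j : 'I_k), i != j -> X i = X j -> phi X = 0).

Definition C := R[i].
Definition iC : C := Complex 0 1.

Definition E1 : 'M[C]_4 :=
  \matrix_(r, c) (if r == c then (if r == 0 :> nat then 3%:R * iC else - iC) else 0).
(* e_{2j} = [[0, -xi_j^T],[xi_j, 0]],  e_{2j+1} = [[0, i xi_j^T],[i xi_j, 0]],  j = 1,2,3 *)
Definition E2 (j : 'I_4) : 'M[C]_4 := - delta_mx 0 j + delta_mx j 0.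
Definition E3 (j : 'I_4) : 'M[C]_4 := iC *: (delta_mx 0 j + delta_mx j 0).

Definition Ebasis (t : 'I_7) : 'M[C]_4 :=
  if t == 0 :> nat then E1
  else if odd t then E2 (inord (t.+1)./2) else E3 (inord (t.+1)./2).

Definition mvec (x : V) : 'M[C]_4 := \sum_(t < 7) (Complex (x 0 t) 0 : C) *: Ebasis t.

(* coordinates of the m-component of Z in su(4) = su(3) (+) m *)
Definition proj_m (Z : 'M[C]_4) : V :=
  \row_(t < 7)
    (if t == 0 :> nat then complex.Im (Z 0 0) / 3%:R
     else if odd t then complex.Re (Z (inord (t.+1)./2) 0) else complex.Im (Z (inord (t.+1)./2) 0)).

Definition brm (x y : V) : V := proj_m (mvec x *m mvec y - mvec y *m mvec x).

Definition conjT (A : 'M[C]_4) : 'M[C]_4 := (map_mx Num.conj A)^T.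

Definition SU3 (A : 'M[C]_3) : Prop :=
  (map_mx Num.conj A)^T *m A = 1%:M /\ determinant A = 1.

Definition emb (A : 'M[C]_3) : 'M[C]_4 := block_mx (1 : 'M[C]_1) 0 0 A.

Definition Ad (A : 'M[C]_3) (x : V) : V :=
  proj_m (emb A *m mvec x *m (emb A)^-1).

Definition su3_invariant (k : nat) (phi : kform k) : Prop :=
  forall A : 'M[C]_3, SU3 A -> forall X : 'I_k -> V, phi (fun t => Ad A (X t)) = phi X.

Definition elem3 (a b c : 'I_7) : kform 3 := fun X =>
  determinant (\matrix_(r < 3, s < 3)
     X r 0 (if s == 0 :> nat then a else if s == 1 :> nat then b else c)).

Definition ix (n : nat) : 'I_7 := inord n.  (* 1-based e^n <-> ix n.-1 *)

Definition e1omega : kform 3 := fun X =>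
  elem3 (ix 0) (ix 1) (ix 2) X + elem3 (ix 0) (ix 3) (ix 4) X + elem3 (ix 0) (ix 5) (ix 6) X.
Definition VR : kform 3 := fun X =>
  elem3 (ix 1) (ix 3) (ix 5) X - elem3 (ix 1) (ix 4) (ix 6) X
  - elem3 (ix 2) (ix 3) (ix 6) X - elem3 (ix 2) (ix 4) (ix 5) X.
Definition VI : kform 3 := fun X =>
  elem3 (ix 2) (ix 3) (ix 5) X - elem3 (ix 2) (ix 4) (ix 6) X
  + elem3 (ix 1) (ix 3) (ix 6) X + elem3 (ix 1) (ix 4) (ix 5) X.

Definition wedge (p q : nat) (a : kform p) (b : kform q) : kform (p + q) := fun X =>
  (p`! * q`!)%:R^-1 *
  \sum_(s : {perm 'I_(p + q)}) (-1) ^+ s * a (fun i => X (s (lshift q i)))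
                                  * b (fun j => X (s (rshift p j))).

Definition contr (k : nat) (x : V) (phi : kform k.+1) : kform k := fun Y =>
  phi (fun t => nth 0 (x :: [seq Y s | s <- enum 'I_k]) t).

(* exterior derivative of an SU(4)-invariant form, computed on m:
   d a (X_0..X_k) = sum_{i<j} (-1)^{i+j} a([X_i,X_j]_m, X_0, ..^i..^j.., X_k) *)
Definition dext (k : nat) (a : kform k) : kform k.+1 := fun X =>
  \sum_(i < k.+1) \sum_(j < k.+1 | (i < j)%N)
    (-1) ^+ (i + j)%N *
    a (fun t => nth 0 (brm (X i) (X j) :: [seq X s | s <- enum 'I_k.+1 & (s != i) && (s != j)]) t).

Definition ip (G : 'M[R]_7) (x y : V) : R := (x *m G *m y^T) 0 0.

Definition pos_def (G : 'M[R]_7) : Prop :=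
  G^T = G /\ forall x : V, x != 0 -> 0 < ip G x x.

(* volume kform c e^{1..7}; it is a volume kform of G iff c^2 = det G
   (c > 0 / c < 0 : the two orientations) *)
Definition volf (c : R) : kform 7 := fun Z =>
  c * determinant (\matrix_(i < 7, j < 7) Z i 0 j).

Definition is_vol (G : 'M[R]_7) (c : R) : Prop := c ^+ 2 = determinant G.

Definition induced (phi : kform 3) (G : 'M[R]_7) (c : R) : Prop :=
  pos_def G /\ is_vol G c /\
  forall (x y : V) (Z : 'I_7 -> V),
    6%:R^-1 * wedge (wedge (contr x phi) (contr y phi)) phi Z = ip G x y * volf c Z.

Definition pos_form (phi : kform 3) : Prop := exists G c, induced phi G c.

(* Hodge star: ( *b)_{J} = 1/k! b^{I} vol_{I J} *)
Definition hodge (G : 'M[R]_7) (c : R) (k : nat) (b : kform k) : kform (7 - k) := fun Y =>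
  (k`!%:R)^-1 *
  \sum_(f : {ffun 'I_k -> 'I_7})
     b (fun t => delta_mx 0 (f t)) *
     volf c (fun t => nth 0 ([seq row (f s) (invmx G) | s <- enum 'I_k]
                             ++ [seq Y s | s <- enum 'I_(7 - k)]) t).

Definition hlap (G : 'M[R]_7) (c : R) (phi : kform 3) : kform 3 := fun X =>
  hodge G c (dext (hodge G c (dext phi))) X
  - dext (hodge G c (dext (hodge G c phi))) X.

(* g_phi and the orientation of phi (well defined for positive phi) *)
Definition metric_of (phi : kform 3) : 'M[R]_7 * R :=
  xget (1%:M, 1) [set p | induced phi p.1 p.2].

Definition G2Lap (phi : kform 3) : kform 3 :=
  hlap (metric_of phi).1 (metric_of phi).2 phi.

Definition posinv (phi : kform 3) : Prop :=
  is_form phi /\ su3_invariant phi /\ pos_form phi.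

Definition same_orientation (phi psi : kform 3) : Prop :=
  exists G c G' c', induced phi G c /\ induced psi G' c' /\ 0 < c * c'.

End G2Lap.

(* Main.v *)
Require Import Defs.
From HB Require Import structures.
From mathcomp Require Import all_boot all_order all_algebra perm.
From mathcomp Require Import all_classical all_reals all_analysis.
From mathcomp.real_closed Require Import complex.
From mathcomp Require Import ring lra zify.
Import Order.TTheory GRing.Theory Num.Theory.
Local Open Scope ring_scope.

(** An SU(3)-invariant 3-form is [a e1omega + b VR + c VI]: the coefficients of a 3-form on basis
    triples are related by the diagonal matrices diag(i, -i, 1), diag(i, 1, -i) and the cyclic
    permutation matrix, which all act on the e_t by signed permutations.
    Such a form is positive iff a <> 0 and b^2 + c^2 = t^3 with t > 0; the metric is then
    diag(a^2/t^2, t, .., t) with volume coefficient a t^2.  Since d(e1omega) = (4/3)(e2345 + e2367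
    + e4567), d VR = -12 e1 /\ VI and d VI = 12 e1 /\ VR, while d * phi = 0, the Laplacian multiplies
    a by (16/9) a^2/t^4 and b, c by 144 t^2/a^2.  It preserves sign a and the phase of b + i c, and
    on (a, t) it is inverted by extracting real roots; the fixed points have t = 16, a = +-192. *)

(** * Forms as lists of terms *)

Section Elem.
Variable R : realType.
Implicit Types l : seq nat.

(** The wedge, d and star of the statement are sums over permutations, pairs of arguments and tuples
    of indices, evaluated on arbitrary vectors, so identities between forms cannot be checked by
    unfolding. Each operator is therefore proved once to act on a minor e^{l_1 .. l_k} by a rule on
    lists of indices. Identities between forms with constant coefficients then become boolean tests
    over the integers, run by [vm_compute]; only a, b, c, the vectors and the metric coefficients
    stay symbolic. For the star a metric diagonal in the basis e_t suffices, since every positive a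
    e1omega + b VR + c VI has one. The image of (a, t) reveals a^3/t^4 and t^7/a^4. The exponents
    (3, -4) and (-4, 7) have determinant 5, so t is found as a fifth root and a afterwards as a cube
    root, which keeps its sign. *)

Definition elem_form (k : nat) (l : seq nat) : kform R k := fun X =>
  \det (\matrix_(r < k, s < k) X r 0 (inord (nth 0%N l s))).

Lemma elem_form_dup k p x q (X : 'I_k -> V R) :
  size (p ++ [:: x, x & q]) = k -> elem_form k (p ++ [:: x, x & q]) X = 0.
Proof.
move=> sk; have p0 : (size p < k)%N by rewrite -sk size_cat /=; lia.
have p1 : ((size p).+1 < k)%N by rewrite -sk size_cat /=; lia.
rewrite /elem_form -det_tr; apply: (@determinant_alternate _ _ _ (Ordinal p0) (Ordinal p1)).
  by rewrite -val_eqE /= neq_ltn ltnSn.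
move=> r; rewrite !mxE /= !nth_cat ltnn subnn ltnNge leqnSn /=.
by rewrite subSn // subnn.
Qed.

Lemma elem_form_swap k p x y q (X : 'I_k -> V R) : size (p ++ [:: x, y & q]) = k ->
  elem_form k (p ++ [:: x, y & q]) X = - elem_form k (p ++ [:: y, x & q]) X.
Proof.
move=> sk; have p0 : (size p < k)%N by rewrite -sk size_cat /=; lia.
have p1 : ((size p).+1 < k)%N by rewrite -sk size_cat /=; lia.
have -> : elem_form k (p ++ [:: x, y & q]) X =
   \det (col_perm (tperm (Ordinal p0) (Ordinal p1))
     (\matrix_(r < k, s < k) X r 0 (inord (nth 0%N (p ++ [:: y, x & q]) s)))).
  congr (\det _); apply/matrixP => r s; rewrite !mxE; congr (X r 0 (inord _)).
  case: tpermP => [-> | -> | /eqP s0 /eqP s1] /=; rewrite !nth_cat ?ltnn ?subnn //=.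
  - by rewrite ltnNge leqnSn /= subSn // subnn.
  - by rewrite ltnNge leqnSn /= subSn // subnn.
  case: ltnP => // ps; move: s0 s1; rewrite -!val_eqE /= => s0 s1.
  by case E: (s - size p)%N => [|[|m]] //=; exfalso; lia.
rewrite col_permE det_mulmx det_perm odd_permV odd_tperm -val_eqE /= neq_ltn ltnSn.
by rewrite expr1 mulrN mulr1.
Qed.

(* The pair (c, l) stands for c e^{l_1 .. l_k}; the indices are 0-based, as in [elem3]. *)
Definition terms_form (k : nat) (s : seq (int * seq nat)) : kform R k := fun X =>
  \sum_(t <- s) t.1%:~R * elem_form k t.2 X.

(* Sorting returns the sign of the permutation, or 0 if an index is repeated. *)
Fixpoint insert_index (x : nat) l : int * seq nat :=
  if l is y :: l' then
    if (x < y)%N then (1, x :: l)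
    else if x == y then (0, x :: l)
    else let: (c, l2) := insert_index x l' in (- c, y :: l2)
  else (1, [:: x]).

Fixpoint sort_index l : int * seq nat :=
  if l is x :: l' then
    let: (c, l1) := sort_index l' in let: (c2, l2) := insert_index x l1 in (c * c2, l2)
  else (1, [::]).

Lemma size_insert_index x l : size (insert_index x l).2 = (size l).+1.
Proof.
elim: l => //= y l IH; case: ifP => // _; case: ifP => // _.
by case: (insert_index x l) IH => c l2 /= ->.
Qed.

Lemma size_sort_index l : size (sort_index l).2 = size l.
Proof.
elim: l => [//|x l] /=; case: (sort_index l) => c l1 /= <-.
by have := size_insert_index x l1; case: (insert_index x l1) => c2 l2 /= ->.
Qed.

(** The prefix [p] makes the induction go through: stepping over [y] costs one adjacent
    transposition and moves [y] to the end of the prefix. *)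
Lemma elem_form_insert k p x l (X : 'I_k -> V R) : size (p ++ x :: l) = k ->
  elem_form k (p ++ x :: l) X = (insert_index x l).1%:~R * elem_form k (p ++ (insert_index x l).2) X.
Proof.
elim: l p => [|y l IH] p sk /=; first by rewrite mul1r.
case: ifP => [_|_]; first by rewrite mul1r.
case: eqP => [exy|_] /=; first by move: sk; rewrite mul0r exy => /elem_form_dup->.
rewrite elem_form_swap //; have := IH (rcons p y).
rewrite !cat_rcons; case: (insert_index x l) => c l2 /= ->; last first.
  by move: sk; rewrite !size_cat /=.
by rewrite mulrNz mulNr.
Qed.

Lemma elem_form_sort k p l (X : 'I_k -> V R) : size (p ++ l) = k ->
  elem_form k (p ++ l) X = (sort_index l).1%:~R * elem_form k (p ++ (sort_index l).2) X.
Proof.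
elim: l p => [|x l IH] p sk /=; first by rewrite mul1r.
have := IH (rcons p x); rewrite !cat_rcons => /(_ sk) ->.
case: (sort_index l) (size_sort_index l) => c l1 /= sl; rewrite elem_form_insert; last first.
  by move: sk; rewrite !size_cat /= sl.
by case: (insert_index x l1) => c2 l2 /=; rewrite intrM mulrA.
Qed.

Fixpoint add_term (c : int) l (acc : seq (int * seq nat)) :=
  if acc is (d, l') :: acc' then
    if l' == l then (d + c, l') :: acc' else (d, l') :: add_term c l acc'
  else [:: (c, l)].

Definition collect (s : seq (int * seq nat)) :=
  foldr (fun t acc => let: (c, l) := sort_index t.2 in add_term (t.1 * c) l acc) [::] s.

(** The bound 7 matters where an index is used as a number, as in the bracket table and in
    contraction: [inord] silently sends larger values to 0. *)
Definition wf_terms k (s : seq (int * seq nat)) := all (fun t => (size t.2 == k) && all (ltn^~ 7) t.2) s.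

Lemma terms_form_cons k t s X : terms_form k (t :: s) X = t.1%:~R * elem_form k t.2 X + terms_form k s X.
Proof. by rewrite /terms_form big_cons. Qed.

Lemma terms_form_cat k s1 s2 X : terms_form k (s1 ++ s2) X = terms_form k s1 X + terms_form k s2 X.
Proof. by rewrite /terms_form big_cat. Qed.

Lemma terms_form_add k c l s X : terms_form k (add_term c l s) X = c%:~R * elem_form k l X + terms_form k s X.
Proof.
elim: s => [|[d l'] s IH] /=; first by rewrite terms_form_cons.
case: eqP => [->|_]; rewrite !terms_form_cons /=; first by rewrite intrD; ring.
by rewrite IH; ring.
Qed.

Lemma terms_form_collect k s X : wf_terms k s -> terms_form k s X = terms_form k (collect s) X.
Proof.
elim: s => [//|[c l] s IH] /= /andP[/andP[/eqP sl _] ws]; rewrite terms_form_cons IH //=.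
have := @elem_form_sort k [::] l X sl; case: (sort_index l) => d l1 /= ->.
by rewrite terms_form_add intrM mulrA.
Qed.

Definition scale_terms (n : int) (s : seq (int * seq nat)) := [seq (n * t.1, t.2) | t <- s].

Lemma terms_form_scale k n s X : terms_form k (scale_terms n s) X = n%:~R * terms_form k s X.
Proof.
rewrite /terms_form big_map mulr_sumr; apply: eq_bigr => t _ /=.
by rewrite intrM mulrA.
Qed.

(** [collect] keeps terms whose coefficient has become 0, so the test looks at the coefficients and
    not for an empty list. *)
Definition eq_terms k (s1 s2 : seq (int * seq nat)) :=
  [&& wf_terms k s1, wf_terms k s2 & all (fun t => t.1 == 0) (collect (s1 ++ scale_terms (-1) s2))].

Lemma terms_form_eq k s1 s2 X : eq_terms k s1 s2 -> terms_form k s1 X = terms_form k s2 X.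
Proof.
case/and3P=> w1 w2 /allP z; apply/eqP; rewrite -subr_eq0; apply/eqP.
have -> : terms_form k s1 X - terms_form k s2 X = terms_form k (s1 ++ scale_terms (-1) s2) X.
  by rewrite terms_form_cat terms_form_scale mulN1r.
rewrite terms_form_collect; first by rewrite /terms_form big_seq big1 // => t /z /eqP ->; rewrite mul0r.
by rewrite /wf_terms all_cat; apply/andP; split => //; rewrite all_map.
Qed.

End Elem.

(** * Determinants, contraction and wedge product *)

Section Ops.
Variable R : realType.
Implicit Types l : seq nat.
Notation elem_form := (@elem_form R). Notation terms_form := (@terms_form R).

Lemma elem3E (a b c : nat) : elem3 (ix a) (ix b) (ix c) = elem_form 3 [:: a; b; c].
Proof.
apply: funext => X; congr (\det _); apply/matrixP => r s; rewrite !mxE /ix.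
by case: s => -[|[|[|//]]] ?.
Qed.

Definition drop_at s l := take s l ++ drop s.+1 l.

Lemma nth_drop_at s l r : (s < size l)%N -> nth 0%N (drop_at s l) r = nth 0%N l (bump s r).
Proof.
move=> sl; rewrite nth_cat size_takel ?(ltnW sl) // /bump [(s <= r)%N]leqNgt.
case: ltnP => rs /=; first by rewrite nth_take.
by rewrite nth_drop; congr (nth _ _ _); rewrite addSn subnKC.
Qed.

(** Laplace expansion along the first row. [M] is arbitrary so that the lemma serves both
    contraction, with the vector x in front, and d, with the bracket of two arguments in front. *)
Lemma elem_form_row0 k l (x : V R) (Y : 'I_k -> V R) (M : 'M[R]_k.+1) : size l = k.+1 ->
  (forall s, M ord0 s = x 0 (inord (nth 0%N l s))) ->
  (forall r s, M (lift ord0 r) s = Y r 0 (inord (nth 0%N l s))) ->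
  \det M = \sum_(s < k.+1) (-1) ^+ s * x 0 (inord (nth 0%N l s)) * elem_form k (drop_at s l) Y.
Proof.
move=> sl M0 M1; rewrite (expand_det_row _ ord0); apply: eq_bigr => s _.
rewrite M0 /cofactor add0n mulrCA mulrA; congr (_ * \det _).
by apply/matrixP => i j; rewrite !mxE M1 nth_drop_at ?sl.
Qed.

Lemma contr_elem_form k (x : V R) l (Y : 'I_k -> V R) : size l = k.+1 ->
  contr x (elem_form k.+1 l) Y =
  \sum_(s < k.+1) (-1) ^+ s * x 0 (inord (nth 0%N l s)) * elem_form k (drop_at s l) Y.
Proof.
move=> sl; apply: elem_form_row0 => // [s|r s]; rewrite mxE //= (nth_map r) ?size_enum_ord.
  by rewrite nth_ord_enum.
exact: ltn_ord.
Qed.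

(** Expand both small determinants. For fixed permutations [u], [v] the sum over [s] is the large
    determinant with its rows permuted blockwise by u and v; the resulting sign cancels theirs, and
    the p! q! equal summands absorb the normalisation of [wedge]. *)
Lemma wedge_elem_form p q l1 l2 (X : 'I_(p + q) -> V R) : size l1 = p -> size l2 = q ->
  wedge (elem_form p l1) (elem_form q l2) X = elem_form (p + q) (l1 ++ l2) X.
Proof.
move=> s1 s2; rewrite /wedge.
pose M : 'M[R]_(p + q) := \matrix_(i, j) X j 0 (inord (nth 0%N (l1 ++ l2) i)).
pose N (u : 'S_p) (v : 'S_q) := block_mx (perm_mx u) 0 0 (perm_mx v) *m M.
have detN u v : \det (N u v) = (-1) ^+ u * (-1) ^+ v * \det M.
  by rewrite det_mulmx det_ublock !det_perm.
have NlE u v i j : N u v (lshift q i) j = X j 0 (inord (nth 0%N l1 (u i))).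
  rewrite /N -[M]vsubmxK mul_block_col !mul0mx addr0 add0r col_mxEu -row_permE !mxE.
  by rewrite /= nth_cat s1 ltn_ord.
have NrE u v i j : N u v (rshift p i) j = X j 0 (inord (nth 0%N l2 (v i))).
  rewrite /N -[M]vsubmxK mul_block_col !mul0mx addr0 add0r col_mxEd -row_permE !mxE.
  by rewrite /= nth_cat s1 ltnNge leq_addr /= addKn.
transitivity ((p`! * q`!)%:R^-1 * \sum_(u : 'S_p) \sum_(v : 'S_q)
     (-1) ^+ u * (-1) ^+ v * \det (N u v)).
  congr (_ * _).
  under [RHS]eq_bigr do under eq_bigr do rewrite /determinant mulr_sumr.
  under [RHS]eq_bigr do rewrite exchange_big /=.
  rewrite exchange_big /=; apply: eq_bigr => s _.
  rewrite /elem_form /determinant -mulrA big_distrlr /= mulr_sumr; apply: eq_bigr => u _.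
  rewrite mulr_sumr; apply: eq_bigr => v _.
  rewrite big_split_ord /=.
  under [X in _ = _ * (_ * (X * _))]eq_bigr do rewrite NlE.
  under [X in _ = _ * (_ * (_ * X))]eq_bigr do rewrite NrE.
  under [X in _ * (_ * X * _) = _]eq_bigr do rewrite mxE.
  under [X in _ * (_ * (_ * X)) = _]eq_bigr do rewrite mxE.
  by rewrite [RHS]mulrCA -!mulrA; congr (_ * (_ * _)); rewrite mulrCA.
have -> : elem_form (p + q) (l1 ++ l2) X = \det M.
  by rewrite -det_tr; congr (\det _); apply/matrixP => i j; rewrite !mxE.
under eq_bigr do under eq_bigr do rewrite detN mulrA mulrACA -!expr2 !sqrr_sign !mul1r.
rewrite !sumr_const !card_Sn -mulrnA -[\det M *+ _]mulr_natl mulrA [(q`! * _)%N]mulnC mulVf ?mul1r //.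
Qed.

(** * Sums over tuples of indices, as they occur in the Hodge star *)

Section Star.
Variables (k m : nat) (L : 'I_k -> 'I_(k + m)) (Lc : 'I_m -> 'I_(k + m)).

(** For complementary [L] and [Lc] this is the permutation matrix of their concatenation. Its
    determinant, a sign, is carried along as a factor, so that its value need not be known at this
    stage. *)
Definition index_mx : 'M[R]_(k + m) :=
  \matrix_(i, j) (i == match fintype.split j with inl a => L a | inr b => Lc b end)%:R.

Lemma index_mx_l i a : index_mx i (lshift m a) = (i == L a)%:R.
Proof. by rewrite mxE (unsplitK (inl _ a)). Qed.

Lemma index_mx_r i b : index_mx i (rshift k b) = (i == Lc b)%:R.
Proof. by rewrite mxE (unsplitK (inr _ b)). Qed.

(** Right multiplication by [index_mx] moves the columns [L] to the front, where the first k rows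
    become an identity block followed by zeros; the block determinant is the minor of [Y] on
    [Lc]. *)
Lemma det_delta_rows (Y : 'I_m -> 'rV[R]_(k + m)) : injective L -> (forall a b, L a != Lc b) ->
  \det (col_mx (\matrix_(i < k) delta_mx 0 (L i)) (\matrix_(i < m) Y i)) * \det index_mx =
  \det (\matrix_(i, j) Y i 0 (Lc j)).
Proof.
move=> injL disj; rewrite -det_mulmx mul_col_mx.
set A := \matrix_(i < k) _; set B := \matrix_(i < m) _.
have AE i c : (A *m index_mx) i c = index_mx (L i) c.
  rewrite mxE (bigD1 (L i)) //= mxE mxE !eqxx mul1r big1 ?addr0 // => t /negbTE ti.
  by rewrite mxE mxE ti andbF mul0r.
rewrite -[A *m _]hsubmxK -[B *m _]hsubmxK -/(block_mx _ _ _ _).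
have -> : lsubmx (A *m index_mx) = 1%:M.
  by apply/matrixP => i j; rewrite mxE AE index_mx_l mxE (inj_eq injL).
have -> : rsubmx (A *m index_mx) = 0.
  by apply/matrixP => i j; rewrite mxE AE index_mx_r mxE (negbTE (disj _ _)).
rewrite det_lblock det1 mul1r; congr (\det _); apply/matrixP => i j.
rewrite !mxE (bigD1 (Lc j)) //= index_mx_r eqxx mulr1 mxE.
by rewrite big1 ?addr0 // => t /negbTE tj; rewrite index_mx_r tj mulr0.
Qed.

Lemma det_perm_rows (w : 'I_k -> R) (s : {perm 'I_k}) (B : 'M[R]_(m, k + m)) :
  \det (col_mx (\matrix_(i < k) (w (s i) *: delta_mx 0 (L (s i)))) B) =
  (-1) ^+ s * (\prod_i w i) * \det (col_mx (\matrix_(i < k) delta_mx 0 (L i)) B).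
Proof.
have -> : col_mx (\matrix_(i < k) (w (s i) *: delta_mx 0 (L (s i)))) B =
    block_mx (perm_mx s *m diag_mx (\row_i w i)) 0 0 1%:M
      *m col_mx (\matrix_(i < k) delta_mx 0 (L i)) B.
  rewrite mul_block_col !mul0mx addr0 add0r mul1mx -mulmxA -row_permE; congr col_mx.
  by apply/matrixP => i j; rewrite mul_diag_mx !mxE.
rewrite det_mulmx det_ublock det_mulmx det_perm det_diag det1 mulr1.
by under eq_bigr do rewrite mxE.
Qed.

Lemma det_rows_cat (A : 'I_k -> 'rV[R]_(k + m)) (Y : 'I_m -> 'rV[R]_(k + m)) :
  \det (\matrix_(i < k + m, j < k + m)
     (nth 0 ([seq A s | s <- enum 'I_k] ++ [seq Y s | s <- enum 'I_m]) i) 0 j) =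
  \det (col_mx (\matrix_(i < k) A i) (\matrix_(i < m) Y i)).
Proof.
congr (\det _); apply/matrixP => i j; rewrite mxE nth_cat size_map size_enum_ord.
case: (split_ordP i) => a ->.
  by rewrite col_mxEu mxE (nth_map a) ?size_enum_ord ?nth_ord_enum //; exact: (ltn_ord a).
rewrite col_mxEd mxE /= addKn (nth_map a) ?size_enum_ord ?nth_ord_enum //.
Qed.

(** In the expansion of the determinant the permutation [s] gives a nonzero product for exactly one
    tuple, g composed with s. *)
Lemma alternating_sum (g : 'I_k -> 'I_(k + m)) (F : ('I_k -> 'I_(k + m)) -> R) :
  \sum_(f : {ffun 'I_k -> 'I_(k + m)})
     \det (\matrix_(r < k, s < k) (f r == g s)%:R) * F f =
  \sum_(s : {perm 'I_k}) (-1) ^+ s * F [ffun r => g (s r)].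
Proof.
under eq_bigr do rewrite mulr_suml.
rewrite exchange_big /=; apply: eq_bigr => s _.
rewrite (bigD1 [ffun r => g (s r)]) //= big1; last by move=> i _; rewrite mxE ffunE eqxx.
rewrite mulr1 big1 ?addr0 // => f nf.
have [/eqfunP fg|/forallPn [i ni]] := boolP [forall i, f i == g (s i)].
  by case/eqP: nf; apply/ffunP => i; rewrite ffunE.
by rewrite (bigD1 i) //= mxE (negbTE ni) mul0r mulr0 mul0r.
Qed.

End Star.
End Ops.

(** * The reductive complement of su(3) in su(4) *)

Section Geom.
Variable R : realType.
Local Notation C := (C R).

(** The second summand of m = R + C^3; SU(3) fixes the first and acts on this one by its standard
    representation. *)
Definition zvec (x : V R) : 'cV[C]_3 :=
  \col_(j < 3) Complex (x 0 (inord j.*2.+1)) (x 0 (inord j.*2.+2)).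

(* The 2-form (x, y) |-> 3 [x, y]_t as a list of c e^{pq}; the factor 3 makes c an integer. *)
Definition bracket_terms (t : nat) : seq (int * (nat * nat)) :=
  if t == 0%N then [:: (-2, (1, 2)%N); (-2, (3, 4)%N); (-2, (5, 6)%N)]
  else if odd t then [:: (12, (0, t.+1)%N)] else [:: (-12, (0, t.-1)%N)].

Lemma complex_ext (u v : C) : complex.Re u = complex.Re v -> complex.Im u = complex.Im v -> u = v.
Proof. by case: u v => a b [c d] /= -> ->. Qed.

Lemma ord3_ind (P : 'I_3 -> Prop) :
  P (inord 0) -> P (inord 1) -> P (inord 2) -> forall j, P j.
Proof.
move=> P0 P1 P2 j; rewrite -[j]inord_val.
by case: j => -[|[|[|]]].
Qed.

Lemma sum_ord7 (W : nmodType) (F : 'I_7 -> W) : \sum_t F t =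
  F (inord 0) + (F (inord 1) + (F (inord 2) + (F (inord 3) + (F (inord 4)
  + (F (inord 5) + F (inord 6)))))).
Proof.
rewrite !big_ord_recl big_ord0 addr0.
by do !congr (_ + _); congr F; apply: val_inj; rewrite /= inordK.
Qed.

Lemma E1_block : E1 R = block_mx (3%:R * iC R)%:M 0 0 (- iC R)%:M :> 'M[C]_(1 + 3).
Proof.
apply/matrixP => r c; case: (split_ordP r) => {}r ->; case: (split_ordP c) => {}c ->.
- by rewrite block_mxEul !mxE !ord1 !eqxx.
- by rewrite block_mxEur !mxE; case: eqP => // /(congr1 val) /=; case: r => -[].
- by rewrite block_mxEdl !mxE; case: eqP => // /(congr1 val) /=; case: c => -[].
- rewrite block_mxEdr !mxE; case: (eqVneq r c) => [->|rc]; first by rewrite eqxx.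
  by case: eqP => // /(@rshift_inj 1 3) e; case/eqP: rc.
Qed.

Lemma E2_block (j : 'I_3) : E2 R (rshift 1 j) =
  block_mx 0 (- delta_mx 0 j) (delta_mx j 0) 0 :> 'M[C]_(1 + 3).
Proof.
apply/matrixP => r c; case: (split_ordP r) => {}r ->; case: (split_ordP c) => {}c ->.
all: rewrite ?block_mxEul ?block_mxEur ?block_mxEdl ?block_mxEdr !mxE ?ord1.
all: by rewrite -?val_eqE /= ?andbF ?add1n ?eqSS ?oppr0 ?addr0 ?add0r.
Qed.

Lemma E3_block (j : 'I_3) : E3 R (rshift 1 j) =
  block_mx 0 (iC R *: delta_mx 0 j) (iC R *: delta_mx j 0) 0 :> 'M[C]_(1 + 3).
Proof.
apply/matrixP => r c; case: (split_ordP r) => {}r ->; case: (split_ordP c) => {}c ->.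
all: rewrite ?block_mxEul ?block_mxEur ?block_mxEdl ?block_mxEdr !mxE ?ord1.
all: by rewrite -?val_eqE /= ?andbF ?add1n ?eqSS ?addr0 ?add0r ?mulr0.
Qed.

Lemma EbasisE : [/\ Ebasis R (inord 0) = E1 R,
  Ebasis R (inord 1) = E2 R (rshift 1 (inord 0)), Ebasis R (inord 2) = E3 R (rshift 1 (inord 0)),
  Ebasis R (inord 3) = E2 R (rshift 1 (inord 1)) & Ebasis R (inord 4) = E3 R (rshift 1 (inord 1))] /\
  Ebasis R (inord 5) = E2 R (rshift 1 (inord 2)) /\ Ebasis R (inord 6) = E3 R (rshift 1 (inord 2)).
Proof.
have r3 (j : nat) : (j < 3)%N -> rshift 1 (inord j : 'I_3) = inord j.+1.
  by move=> j3; apply: val_inj; rewrite /= !inordK.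
by rewrite /Ebasis !inordK // !r3.
Qed.

Lemma inord3_neq : ((inord 0 == inord 1 :> 'I_3) = false) * ((inord 0 == inord 2 :> 'I_3) = false)
  * ((inord 1 == inord 0 :> 'I_3) = false) * ((inord 1 == inord 2 :> 'I_3) = false)
  * ((inord 2 == inord 0 :> 'I_3) = false) * ((inord 2 == inord 1 :> 'I_3) = false).
Proof. by rewrite -!val_eqE /= !inordK. Qed.

Lemma mvec_block (x : V R) :
  mvec x = block_mx (Complex 0 (3 * x 0 0))%:M (- map_mx Num.conj (zvec x)^T)
                    (zvec x) (Complex 0 (- x 0 0))%:M :> 'M[C]_(1 + 3).
Proof.
have x0 : x 0 0 = x 0 (inord 0) by congr (x _ _); apply: val_inj; rewrite /= inordK.
apply/matrixP => r c.
have -> : mvec x r c = \sum_t (Complex (x 0 t) 0 : C) * (Ebasis R t : 'M[C]_(1 + 3)) r c.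
  by rewrite /mvec summxE; apply: eq_bigr => t _; rewrite mxE.
rewrite sum_ord7; have [[-> -> -> -> ->] [-> ->]] := EbasisE; rewrite x0 E1_block !E2_block !E3_block.
case: (split_ordP r) => {}r ->; case: (split_ordP c) => {}c ->.
- by rewrite !block_mxEul !mxE !ord1 !mulr0 !addr0 !mulr1n; apply: complex_ext => /=; ring.
- by rewrite !block_mxEur !ord1 !mxE; move: c; apply: ord3_ind;
    rewrite ?eqxx ?inord3_neq /= ?(oppr0, mulr0, addr0, add0r, inordK) // ?mulr1;
    apply: complex_ext; rewrite /= ?doubleS ?double0; ring.
- by rewrite !block_mxEdl !ord1 !mxE; move: r; apply: ord3_ind;
    rewrite ?eqxx ?inord3_neq /= ?(oppr0, mulr0, addr0, add0r, inordK) // ?mulr1;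
    apply: complex_ext; rewrite /= ?doubleS ?double0; ring.
rewrite !block_mxEdr !mxE !mulr0 !addr0 mulrnAr; congr (_ *+ _); apply: complex_ext => /=; ring.
Qed.

Lemma proj_m0 (a : 'M[C]_1) b (z0 : 'cV[C]_3) d :
  proj_m (block_mx a b z0 d : 'M[C]_(1 + 3)) 0 0 = complex.Im (a 0 0) / 3.
Proof.
have z : (0 : 'I_4) = lshift 3 (0 : 'I_1) by apply: val_inj.
by rewrite -[X in _ = complex.Im X / _](block_mxEul a b z0 d) mxE /= z.
Qed.

Lemma zvec_proj (M : 'M[C]_4) (j : 'I_3) k : zvec (proj_m M) j k = M (inord j.+1) 0.
Proof.
rewrite ord1 mxE !mxE.
have j7 : (j.*2.+2 < 7)%N by case: j => -[|[|[|]]].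
rewrite !inordK ?(ltnW j7) //= uphalf_double odd_double /=.
by rewrite doubleK; case: (M _ _).
Qed.

Lemma zvec_proj_m (a : 'M[C]_1) b (z : 'cV[C]_3) d :
  zvec (proj_m (block_mx a b z d : 'M[C]_(1 + 3))) = z.
Proof.
apply/matrixP => j k; rewrite zvec_proj ord1 -[RHS](block_mxEdl a b z d).
have -> : inord j.+1 = rshift 1 j by apply/val_inj; rewrite /= inordK //; case: j => -[|[|[|]]].
by have -> : (0 : 'I_4) = lshift 3 (0 : 'I_1) by apply/val_inj.
Qed.

Lemma zvecE (x : V R) (j : nat) : (j < 3)%N ->
  zvec x (inord j) 0 = Complex (x 0 (inord j.*2.+1)) (x 0 (inord j.*2.+2)).
Proof. by move=> j3; rewrite mxE inordK. Qed.

Lemma comm_block m n (M M' : 'M[C]_(m + n)) a b c d a' b' c' d' :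
  M = block_mx a b c d -> M' = block_mx a' b' c' d' ->
  M *m M' - M' *m M =
    block_mx (a *m a' + b *m c' - (a' *m a + b' *m c)) (a *m b' + b *m d' - (a' *m b + b' *m d))
             (c *m a' + d *m c' - (c' *m a + d' *m c)) (c *m b' + d *m d' - (c' *m b + d' *m d)).
Proof. by move=> -> ->; rewrite !mulmx_block opp_block_mx add_block_mx. Qed.

Lemma conj_block m n (A M A' : 'M[C]_(m + n)) a b c d u v :
  A = block_mx 1%:M 0 0 u -> M = block_mx a b c d -> A' = block_mx 1%:M 0 0 v ->
  A *m M *m A' = block_mx a (b *m v) (u *m c) (u *m d *m v).
Proof.
by move=> -> -> ->; rewrite !mulmx_block !(mulmx0, mul0mx, addr0, add0r, mul1mx, mulmx1).
Qed.

Lemma brm0 (x y : V R) : brm x y 0 0 = - (2 / 3) * complex.Im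
  (((map_mx Num.conj (zvec x)^T) *m zvec y) 0 0).
Proof.
rewrite /brm (@comm_block 1 3 _ _ _ _ _ _ _ _ _ _ (mvec_block x) (mvec_block y)) proj_m0.
rewrite !mulNmx !mul_scalar_mx !mxE !big_ord_recl !big_ord0 !mxE /=; by field.
Qed.

Lemma zvec_brm (x y : V R) : zvec (brm x y) =
  Complex 0 (4 * y 0 0) *: zvec x - Complex 0 (4 * x 0 0) *: zvec y.
Proof.
rewrite /brm (@comm_block 1 3 _ _ _ _ _ _ _ _ _ _ (mvec_block x) (mvec_block y)) zvec_proj_m.
rewrite !mul_mx_scalar !mul_scalar_mx; apply/matrixP => j k; rewrite !mxE.
by apply: complex_ext => /=; ring.
Qed.

(** The table is read off from [x, y]_0 = -(2/3) omega(x, y) and, on C^3, 4i (y_0 z_x - x_0 z_y);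
    times 3 this gives the entries -2 and +-12. *)
Lemma brmE (x y : V R) t : (t < 7)%N -> brm x y 0 (inord t) =
  3^-1 * \sum_(b <- bracket_terms t) b.1%:~R * (x 0 (inord b.2.1) * y 0 (inord b.2.2)
                                   - y 0 (inord b.2.1) * x 0 (inord b.2.2)).
Proof.
have i0 : inord 0 = 0 :> 'I_7 by apply: val_inj; rewrite /= inordK.
have re j : (j < 3)%N -> brm x y 0 (inord j.*2.+1) = complex.Re (zvec (brm x y) (inord j) 0).
  by move=> j3; rewrite zvecE.
have im j : (j < 3)%N -> brm x y 0 (inord j.*2.+2) = complex.Im (zvec (brm x y) (inord j) 0).
  by move=> j3; rewrite zvecE.
case: t => [|[|[|[|[|[|[|//]]]]]]] _.
- rewrite i0 brm0 mxE !big_ord_recl big_ord0 !mxE /bracket_terms /= !big_cons big_nil /=; by field.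
- rewrite (re 0%N) // zvec_brm !mxE inordK //= /bracket_terms /= big_seq1 i0 /=; by field.
- rewrite (im 0%N) // zvec_brm !mxE inordK //= /bracket_terms /= big_seq1 i0 /=; by field.
- rewrite (re 1%N) // zvec_brm !mxE inordK //= /bracket_terms /= big_seq1 i0 /=; by field.
- rewrite (im 1%N) // zvec_brm !mxE inordK //= /bracket_terms /= big_seq1 i0 /=; by field.
- rewrite (re 2%N) // zvec_brm !mxE inordK //= /bracket_terms /= big_seq1 i0 /=; by field.
- rewrite (im 2%N) // zvec_brm !mxE inordK //= /bracket_terms /= big_seq1 i0 /=; by field.
Qed.

Lemma emb_inv (A : 'M[C]_3) : SU3 A -> (emb A)^-1 = emb (map_mx Num.conj A)^T.
Proof.
move=> [AA _]; have e : emb (map_mx Num.conj A)^T *m emb A = 1%:M.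
  have := @conj_block 1 3 (emb (map_mx Num.conj A)^T) 1%:M (emb A) _ _ _ _ _ _
     erefl (scalar_mx_block 1 3 1) erefl.
  by rewrite mulmx1 => ->; rewrite mulmx1 mul0mx mulmx0 AA -scalar_mx_block.
have [u _] := mulmx1_unit (mulmx1C e).
by rewrite -[LHS]mul1mx -e -mulmxA mulmxV // mulmx1.
Qed.

Lemma Ad_block (A : 'M[C]_3) (x : V R) : SU3 A ->
  Ad A x = proj_m (block_mx (Complex 0 (3 * x 0 0))%:M
    (- map_mx Num.conj (zvec x)^T *m (map_mx Num.conj A)^T)
    (A *m zvec x) (A *m (Complex 0 (- x 0 0))%:M *m (map_mx Num.conj A)^T) : 'M[C]_(1 + 3)).
Proof.
move=> hA; rewrite /Ad emb_inv //; congr proj_m.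
exact: (@conj_block 1 3 _ _ _ _ _ _ _ _ _ erefl (mvec_block x) erefl).
Qed.

Lemma Ad0 (A : 'M[C]_3) (x : V R) : SU3 A -> Ad A x 0 0 = x 0 0.
Proof. by move=> hA; rewrite Ad_block // proj_m0 mxE eqxx /=; field. Qed.

Lemma zvec_Ad (A : 'M[C]_3) (x : V R) : SU3 A -> zvec (Ad A x) = A *m zvec x.
Proof. by move=> hA; rewrite Ad_block // zvec_proj_m. Qed.

End Geom.

(** * Exterior derivative *)

Section Dext.
Variable R : realType.
Implicit Types l : seq nat.
Notation elem_form := (@elem_form R). Notation terms_form := (@terms_form R).

(** Matches the list of remaining arguments in [dext] with the double [lift] left by two cofactor
    expansions: two strictly increasing lists with the same members coincide. *)
Lemma filter_lift n (i : 'I_n.+2) (j : 'I_n.+1) :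
  [seq s <- enum 'I_n.+2 | (s != i) && (s != lift i j)] =
  [seq lift i (lift j r) | r <- enum 'I_n].
Proof.
have ltnT : transitive (fun a b : 'I_n.+2 => (a < b)%N) by move=> ? ? ?; apply: ltn_trans.
have sortedE m : sorted (fun a b : 'I_m => (a < b)%N) (enum 'I_m).
  by have := iota_ltn_sorted 0 m; rewrite -val_enum_ord sorted_map.
apply: (irr_sorted_eq ltnT) => [a|||s]; first exact: ltnn.
- by apply: (sorted_filter ltnT); apply: sortedE.
- rewrite sorted_map; apply: sub_sorted (sortedE n) => a b ab /=.
  by rewrite ltnNge !leq_bump2 -ltnNge.
rewrite mem_filter mem_enum andbT; apply/idP/mapP => [/andP[si sij]|[r _ ->]].
  case: (unliftP i s) si sij => [s' ->|->]; last by rewrite eqxx.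
  rewrite (inj_eq lift_inj) => _; case: (unliftP j s') => [r ->|->]; last by rewrite eqxx.
  by move=> _; exists r; rewrite ?mem_enum.
by rewrite (inj_eq lift_inj) ![lift _ _ == _]eq_sym !neq_lift.
Qed.

Lemma elem_form_col0 n p l (X : 'I_n.+1 -> V R) :
  elem_form n.+1 (p :: l) X =
  \sum_(i < n.+1) (-1) ^+ i * X i 0 (inord p) * elem_form n l (fun r => X (lift i r)).
Proof.
rewrite [LHS](expand_det_col _ ord0); apply: eq_bigr => i _.
rewrite mxE /cofactor addn0 mulrCA mulrA; congr (_ * \det _).
by apply/matrixP => a b; rewrite !mxE.
Qed.

Definition others {n} (X : 'I_n.+2 -> V R) (i j : 'I_n.+2) : 'I_n -> V R :=
  fun t => nth 0 [seq X s | s <- enum 'I_n.+2 & (s != i) && (s != j)] t.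

(** Expand along two columns and pair (i, j) with (j, i). Once row i is deleted, row j moves up by
    one exactly when i < j; this is the extra exponent in [e], and it produces the leading minus
    sign. *)
Lemma laplace2 n p q l (X : 'I_n.+2 -> V R) :
  elem_form n.+2 [:: p, q & l] X =
  - \sum_(i < n.+2) \sum_(j < n.+2 | (i < j)%N)
     (-1) ^+ (i + j) * (X i 0 (inord p) * X j 0 (inord q) - X j 0 (inord p) * X i 0 (inord q))
     * elem_form n l (others X i j).
Proof.
pose e (i j : 'I_n.+2) : R := (-1) ^+ (i + j + (i < j)%N).
pose F i j := e i j * (X i 0 (inord p) * X j 0 (inord q)) * elem_form n l (others X i j).
have -> : elem_form n.+2 [:: p, q & l] X = \sum_i \sum_(j | j != i) F i j.
  rewrite elem_form_col0; apply: eq_bigr => i _.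
  rewrite elem_form_col0 [in RHS]big_mkcond (bigD1_ord i) //= eqxx /= add0r mulr_sumr.
  apply: eq_bigr => j _; rewrite eq_sym neq_lift /F.
  have -> : e i (lift i j) = (-1) ^+ i * (-1) ^+ j.
    rewrite -exprD /e /= /bump; case: (leqP i j) => ij /=.
      by rewrite add1n ltnS ij addn1 addnS !exprS !mulN1r opprK.
    by rewrite add0n ltnNge (ltnW ij) addn0.
  suff -> : others X i (lift i j) = fun r => X (lift i (lift j r)) by ring.
  apply: funext => r; rewrite /others filter_lift -map_comp (nth_map r) ?size_enum_ord //=.
  by rewrite nth_ord_enum.
have split_ij i : \sum_(j | j != i) F i j =
   \sum_(j < n.+2 | (i < j)%N) F i j + \sum_(j < n.+2 | (j < i)%N) F i j.
  rewrite (bigID (fun j : 'I_n.+2 => (i < j)%N)) /=; congr (_ + _); apply: eq_bigl => j.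
    by rewrite -val_eqE /=; lia.
  by rewrite -val_eqE /=; lia.
under eq_bigr do rewrite split_ij.
rewrite big_split /= [X in _ + X](exchange_big_dep predT) //= -big_split /=.
rewrite -sumrN; apply: eq_bigr => i _; rewrite -big_split /= -sumrN.
apply: eq_bigr => j ij; rewrite /F.
have -> : others X j i = others X i j.
  by rewrite /others; under eq_filter do rewrite andbC.
rewrite /e ij (ltnNge j i) (ltnW ij) /= addn0 addn1 exprS (addnC j i); ring.
Qed.

(** Leibniz rule for 3 d, with 3 d e^t = - [bracket_terms t]: moving the i-th factor to the front
    costs (-1)^i, and the 2-form then replaces it there. *)
Definition dext_terms (s : seq (int * seq nat)) : seq (int * seq nat) :=
  flatten [seq flatten [seq [seq (- ((-1) ^+ i * t.1 * b.1), [:: b.2.1, b.2.2 & drop_at i t.2])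
    | b <- bracket_terms (nth 0%N t.2 i)] | i <- iota 0 (size t.2)] | t <- s].

Lemma dext_elem_form n l (X : 'I_n.+2 -> V R) : size l = n.+1 -> all (ltn^~ 7) l ->
  dext (elem_form n.+1 l) X = 3^-1 * terms_form n.+2 (dext_terms [:: (1, l)]) X.
Proof.
move=> sl l7.
(* Contribution of the arguments i < j, the position s in [l] and the bracket term b. With the sums
   over i and j innermost, [laplace2] applies for each s and b. *)
pose T (i j : 'I_n.+2) (s : nat) (b : int * (nat * nat)) : R := 3^-1 * ((-1) ^+ s * b.1%:~R * ((-1) ^+ (i + j) *
  (X i 0 (inord b.2.1) * X j 0 (inord b.2.2) - X j 0 (inord b.2.1) * X i 0 (inord b.2.2)) *
   elem_form n (drop_at s l) (others X i j))).
have -> : dext (elem_form n.+1 l) X = \sum_(i < n.+2) \sum_(j < n.+2 | (i < j)%N)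
    \sum_(s < n.+1) \sum_(b <- bracket_terms (nth 0%N l s)) T i j s b.
  apply: eq_bigr => i _; apply: eq_bigr => j ij.
  rewrite [X in _ * X = _](@elem_form_row0 _ _ l (brm (X i) (X j)) (others X i j)) //.
  - rewrite mulr_sumr; apply: eq_bigr => s _; rewrite brmE /T; last first.
      by apply: (allP l7); rewrite mem_nth // sl.
    move: (elem_form n _ _) => D; rewrite !mulr_sumr mulr_suml mulr_sumr; apply: eq_bigr => b _.
    by ring.
  - by move=> s; rewrite mxE.
  - by move=> r s; rewrite mxE.
transitivity (\sum_(s < n.+1) \sum_(b <- bracket_terms (nth 0%N l s))
    \sum_(i < n.+2) \sum_(j < n.+2 | (i < j)%N) T i j s b).
  under eq_bigr do rewrite exchange_big /=.
  rewrite exchange_big /=; apply: eq_bigr => s _.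
  rewrite [RHS]exchange_big; apply: eq_bigr => i _.
  by rewrite [RHS]exchange_big.
rewrite /dext_terms [flatten _]cats0 /terms_form big_flatten [size _]sl big_map.
rewrite -[iota 0 n.+1]/(index_iota 0 n.+1) big_mkord mulr_sumr; apply: eq_bigr => s _.
rewrite big_map mulr_sumr; apply: eq_bigr => b _ /=.
rewrite laplace2 mulrN -mulNr mulrA mulr_sumr; apply: eq_bigr => i _.
rewrite mulr_sumr; apply: eq_bigr => j _.
by rewrite /T -mulrNz opprK mulr1 intrM [((-1) ^+ s)%:~R]rmorphXn /= rmorphN1; ring.
Qed.

End Dext.

(** * Hodge star *)

Section Lin.
Variable R : realType.
Notation elem_form := (@elem_form R). Notation terms_form := (@terms_form R).
Variables (I J : Type) (r : seq I) (r' : seq J).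

Lemma wedge_lin p q (c : I -> R) (d : J -> R) (a : I -> kform R p) (b : J -> kform R q) Z :
  wedge (fun X => \sum_(i <- r) c i * a i X) (fun X => \sum_(j <- r') d j * b j X) Z =
  \sum_(i <- r) \sum_(j <- r') c i * d j * wedge (a i) (b j) Z.
Proof.
under [RHS]eq_bigr do under eq_bigr do rewrite /wedge mulrCA mulr_sumr.
under [RHS]eq_bigr do rewrite -mulr_sumr exchange_big /=.
rewrite -mulr_sumr exchange_big /=; congr (_ * _); apply: eq_bigr => s _.
rewrite -mulrA big_distrlr /= mulr_sumr; apply: eq_bigr => i _.
by rewrite mulr_sumr; apply: eq_bigr => j _; move: ((-1) ^+ _) (a i _) (b j _) => ? ? ?; ring.
Qed.

Lemma dext_lin k (c : I -> R) (a : I -> kform R k) X :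
  dext (fun X => \sum_(i <- r) c i * a i X) X = \sum_(i <- r) c i * dext (a i) X.
Proof.
under [RHS]eq_bigr do rewrite mulr_sumr.
rewrite exchange_big /=; apply: eq_bigr => i _.
under [RHS]eq_bigr do rewrite mulr_sumr.
rewrite exchange_big /=; apply: eq_bigr => j _.
by rewrite mulr_sumr; apply: eq_bigr => t _; rewrite mulrCA.
Qed.

Lemma hodge_lin k G g (c : I -> R) (a : I -> kform R k) Y :
  hodge G g (fun X => \sum_(i <- r) c i * a i X) Y = \sum_(i <- r) c i * hodge G g (a i) Y.
Proof.
under [RHS]eq_bigr do rewrite mulrCA mulr_sumr.
rewrite -mulr_sumr; congr (_ * _); rewrite exchange_big /=; apply: eq_bigr => f _.
by rewrite mulr_suml; apply: eq_bigr => t _; rewrite -mulrA.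
Qed.

Lemma contr_lin k x (c : I -> R) (a : I -> kform R k.+1) Y :
  contr x (fun X => \sum_(i <- r) c i * a i X) Y = \sum_(i <- r) c i * contr x (a i) Y.
Proof. by []. Qed.

End Lin.

(** * The operators on lists of terms *)

Section SemOps.
Variable R : realType.
Notation elem_form := (@elem_form R). Notation terms_form := (@terms_form R).

Definition wedge_terms (s t : seq (int * seq nat)) :=
  [seq (u.1 * v.1, u.2 ++ v.2) | u <- s, v <- t].

Lemma wedge_terms_form p q s t (X : 'I_(p + q) -> V R) : wf_terms p s -> wf_terms q t ->
  wedge (terms_form p s) (terms_form q t) X = terms_form (p + q) (wedge_terms s t) X.
Proof.
move=> /allP ws /allP wt; rewrite /terms_form wedge_lin big_allpairs_dep /=.
apply: eq_big_seq => u /ws /andP[/eqP su _]; apply: eq_big_seq => v /wt /andP[/eqP sv _].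
by rewrite wedge_elem_form // intrM.
Qed.

Definition contr_terms (m : nat) (s : seq (int * seq nat)) : seq (int * seq nat) :=
  flatten [seq [seq ((-1) ^+ i * t.1, drop_at i t.2) | i <- iota 0 (size t.2) & nth 0%N t.2 i == m]
    | t <- s].

Lemma contr_terms_form k (x : V R) s (Y : 'I_k -> V R) : wf_terms k.+1 s ->
  contr x (terms_form k.+1 s) Y = \sum_(m < 7) x 0 m * terms_form k (contr_terms m s) Y.
Proof.
move=> /allP ws; rewrite /terms_form contr_lin.
under [RHS]eq_bigr do rewrite /contr_terms big_flatten /= big_map mulr_sumr.
rewrite exchange_big /=; apply: eq_big_seq => -[c l] /ws /= /andP[/eqP sl /allP l7].
rewrite contr_elem_form // mulr_sumr.
under [RHS]eq_bigr do rewrite big_map big_filter mulr_sumr [size _]sl -[iota 0 k.+1]/(index_iota 0 k.+1) big_mkord /=.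
under [RHS]eq_bigr do rewrite big_mkcond.
rewrite exchange_big /=; apply: eq_bigr => i _.
have il : (nth 0%N l i < 7)%N by apply: l7; rewrite mem_nth // sl.
rewrite (bigD1 (inord (nth 0%N l i))) //= inordK // eqxx big1 ?addr0 => [|m].
  by rewrite intrM [((-1) ^+ i)%:~R]rmorphXn /= rmorphN1; ring.
by rewrite -val_eqE /= inordK // eq_sym => /negbTE ->.
Qed.

Lemma dext_terms_cons t s : dext_terms (t :: s) = dext_terms [:: t] ++ dext_terms s.
Proof. by rewrite /dext_terms /= cats0. Qed.

Lemma dext_terms_scale n c l (X : 'I_n -> V R) : terms_form n (dext_terms [:: (c, l)]) X = c%:~R * terms_form n (dext_terms [:: (1, l)]) X.
Proof.
rewrite -terms_form_scale /dext_terms /= !cats0 /scale_terms map_flatten -map_comp; congr (terms_form _ (flatten _) _).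
apply: eq_map => i /=; rewrite -map_comp; apply: eq_map => b /=; congr (_, _); ring.
Qed.

Lemma dext_terms_form n s (X : 'I_n.+2 -> V R) : wf_terms n.+1 s ->
  dext (terms_form n.+1 s) X = 3^-1 * terms_form n.+2 (dext_terms s) X.
Proof.
rewrite /terms_form dext_lin -/(terms_form _ _ _); elim: s => [|[c l] s IH] /=.
  by move=> _; rewrite /dext_terms /terms_form /= !big_nil mulr0.
move=> /andP[/andP[/eqP sl l7]] /IH e; rewrite big_cons e dext_terms_cons terms_form_cat dext_terms_scale.
by rewrite mulrDr dext_elem_form //=; congr (_ + _); rewrite mulrCA.
Qed.

Definition compl (l : seq nat) := [seq i <- iota 0 7 | i \notin l].

(** A decidable certificate that l followed by its complement permutes 0, .., 6 with sign [u.1].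
    That the sign squares to 1 allows it to be moved across an equation. *)
Definition hodge_perm (l : seq nat) := let u := sort_index (l ++ compl l) in
  [&& uniq (l ++ compl l), all (ltn^~ 7) (l ++ compl l), u.2 == iota 0 7 & u.1 * u.1 == 1].

Lemma row_invmx_diag n (d : 'rV[R]_n) j : (forall i, d 0 i != 0) ->
  row j (invmx (diag_mx d)) = (d 0 j)^-1 *: delta_mx 0 j.
Proof.
move=> d0; have e : diag_mx (\row_i (d 0 i)^-1) *m diag_mx d = 1%:M.
  rewrite mulmx_diag; apply/matrixP => a b; rewrite !mxE.
  by case: eqP => [->|]; rewrite ?mulVf.
have [_ u] := mulmx1_unit e.
have -> : invmx (diag_mx d) = diag_mx (\row_i (d 0 i)^-1).
  by rewrite -[LHS]mul1mx -e -mulmxA mulmxV // mulmx1.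
apply/matrixP => a b; rewrite !mxE ord1 eqxx /=.
by rewrite [b == j]eq_sym; case: (j == b); rewrite ?mulr1 ?mulr0.
Qed.

Lemma elem_form_top (Z : 'I_7 -> V R) : elem_form 7 (iota 0 7) Z = \det (\matrix_(i < 7, j < 7) Z i 0 j).
Proof.
congr (\det _); apply/matrixP => i j; rewrite !mxE; congr (Z i 0 _).
by rewrite nth_iota // inord_val.
Qed.

(** Only the k! rearrangements of [L] survive in the sum. Each carries its sign twice, once from the
    minor and once from the volume form, so all contribute equally. The weights [w] stand for a
    diagonal inverse metric. *)
Lemma star_sum (k m : nat) (L : 'I_k -> 'I_(k + m)) (Lc : 'I_m -> 'I_(k + m))
    (w : 'I_(k + m) -> R) (Y : 'I_m -> 'rV[R]_(k + m)) :
  injective L -> (forall a b, L a != Lc b) ->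
  (\sum_(f : {ffun 'I_k -> 'I_(k + m)})
     \det (\matrix_(r < k, s < k) (f r == L s)%:R) *
     \det (\matrix_(i < k + m, j < k + m)
       (nth 0 ([seq w (f s) *: delta_mx 0 (f s) | s <- enum 'I_k]
               ++ [seq Y s | s <- enum 'I_m]) i) 0 j)) * \det (index_mx R k m L Lc) =
  k`!%:R * \prod_i w (L i) * \det (\matrix_(i, j) Y i 0 (Lc j)).
Proof.
move=> injL disj.
set F := fun f : 'I_k -> 'I_(k + m) => \det (\matrix_(i < k + m, j < k + m)
       (nth 0 ([seq w (f s) *: delta_mx 0 (f s) | s <- enum 'I_k]
               ++ [seq Y s | s <- enum 'I_m]) i) 0 j).
pose D := \prod_i w (L i)
  * \det (col_mx (\matrix_(i < k) delta_mx 0 (L i)) (\matrix_(i < m) Y i)).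
transitivity ((\sum_(s : {perm 'I_k}) D) * \det (index_mx R k m L Lc)); last first.
  by rewrite sumr_const card_Sn -[D *+ _]mulr_natl /D -!mulrA det_delta_rows.
congr (_ * _); rewrite -[LHS]/(\sum_(f : {ffun 'I_k -> 'I_(k + m)})
  \det (\matrix_(r < k, s < k) (f r == L s)%:R) * F f) alternating_sum.
apply: eq_bigr => s _; rewrite /F det_rows_cat.
under eq_mx => i j do rewrite !ffunE.
by rewrite (det_perm_rows _ _ _ _ (w \o L)) /D !mulrA -expr2 sqrr_sign mul1r.
Qed.

(** For a variable k, 7 and k + (7 - k) are not convertible. Here the equation can be substituted
    away, and a single map [P] on nat replaces the pair [L], [Lc], so no casts appear. *)
Lemma star_sum_index (n k m : nat) (e : n = (k + m)%N) (P : nat -> 'I_n)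
    (w : 'I_n -> R) (Y : 'I_m -> 'rV[R]_n) : {in gtn n &, injective P} ->
  (\sum_(f : {ffun 'I_k -> 'I_n})
     \det (\matrix_(r < k, s < k) (f r == P s)%:R) *
     \det (\matrix_(i < n, j < n)
       (nth 0 ([seq w (f s) *: delta_mx 0 (f s) | s <- enum 'I_k]
               ++ [seq Y s | s <- enum 'I_m]) i) 0 j)) *
    \det (\matrix_(i < n, j < n) (i == P j)%:R) =
  k`!%:R * \prod_(i < k) w (P i) * \det (\matrix_(i < m, j < m) Y i 0 (P (k + j)%N)).
Proof.
subst n => injP.
have ltk (a : 'I_k) : (a < k + m)%N by rewrite ltn_addr.
have ltm (b : 'I_m) : (k + b < k + m)%N by rewrite ltn_add2l.
rewrite -(star_sum k m (fun a => P a) (fun b => P (k + b)%N)).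
- congr (_ * \det _); apply/matrixP => i j; rewrite !mxE.
  by case: (split_ordP j) => a ->.
- by move=> a b /injP e; apply: val_inj; apply: e; rewrite inE ltk.
move=> a b; apply/eqP => /injP; rewrite !inE => /(_ (ltk a) (ltm b)).
by move=> e; have := ltn_ord a; rewrite e ltnNge leq_addr.
Qed.

Lemma hodge_elem_form (d : 'rV[R]_7) c k l Y : (forall i, d 0 i != 0) ->
  size l = k -> (k <= 7)%N -> hodge_perm l ->
  hodge (diag_mx d) c (elem_form k l) Y =
  c * \prod_(i <- l) (d 0 (inord i))^-1 *
    ((sort_index (l ++ compl l)).1%:~R * elem_form (7 - k) (compl l) Y).
Proof.
move=> d0 sl k7 /and4P[ul al /eqP si /eqP ss].
have e : 7 = (k + (7 - k))%N by rewrite subnKC.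
pose P j : 'I_7 := inord (nth 0%N (l ++ compl l) j).
have sz : size (l ++ compl l) = 7 by rewrite -size_sort_index si.
have lt7 j : (j < 7)%N -> (nth 0%N (l ++ compl l) j < 7)%N.
  by move=> j7; apply: (allP al); rewrite mem_nth // sz.
have injP : {in gtn 7 &, injective P}.
  move=> i j i7 j7 /(congr1 val); rewrite /= !inordK ?lt7 // => /eqP.
  by rewrite nth_uniq ?sz // => /eqP.
have := @star_sum_index _ _ _ e P (fun i => (d 0 i)^-1) Y injP.
have -> : \det (\matrix_(i < 7, j < 7) (i == P j)%:R) = (sort_index (l ++ compl l)).1%:~R :> R.
  (* Sorting evaluated on the standard basis: the sorted minor is 1, so the determinant of the index
     matrix equals the sorting sign. *)
  have := @elem_form_sort R 7 [::] (l ++ compl l) (fun i => delta_mx 0 i) sz.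
  rewrite si elem_form_top => h; transitivity (elem_form 7 (l ++ compl l) (fun i => delta_mx 0 i)).
    by congr (\det _); apply/matrixP => i j; rewrite !mxE eqxx /= eq_sym.
  rewrite {}h -[RHS]mulr1; congr (_ * _); rewrite -[RHS](det1 _ 7); congr (\det _).
  by apply/matrixP => i j; rewrite !mxE eqxx /= eq_sym.
set S := \sum_f _ => h.
have {}h : S = k`!%:R * \prod_(i < k) (d 0 (P i))^-1 *
    (sort_index (l ++ compl l)).1%:~R * elem_form (7 - k) (compl l) Y.
  have s2 : (sort_index (l ++ compl l)).1%:~R * (sort_index (l ++ compl l)).1%:~R = 1 :> R by rewrite -intrM ss.
  have -> : elem_form (7 - k) (compl l) Y =
      \det (\matrix_(i < 7 - k, j < 7 - k) Y i 0 (P (k + j)%N)).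
    rewrite /elem_form; congr (\det _); apply/matrixP => i j; rewrite !mxE /P nth_cat sl.
    by rewrite ltnNge leq_addr /= addKn.
  by rewrite -[LHS]mulr1 -[X in _ * X = _]s2 mulrA h mulrAC.
have -> : hodge (diag_mx d) c (elem_form k l) Y = (k`!%:R)^-1 * (c * S).
  congr (_ * _); rewrite /S mulr_sumr; apply: eq_bigr => f _.
  rewrite mulrCA; congr (_ * (_ * _)).
    rewrite /elem_form; congr (\det _); apply/matrixP => i j; rewrite !mxE eqxx /= /P nth_cat sl ltn_ord.
    by rewrite eq_sym.
  congr (\det _); apply/matrixP => i j; rewrite !mxE.
  suff -> : [seq row (f s) (invmx (diag_mx d)) | s <- enum 'I_k] =
            [seq (d 0 (f s))^-1 *: delta_mx 0 (f s) | s <- enum 'I_k] by [].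
  by apply: eq_map => s; rewrite row_invmx_diag.
have -> : \prod_(i <- l) (d 0 (inord i))^-1 = \prod_(i < k) (d 0 (P i))^-1.
  rewrite (big_nth 0%N) big_mkord sl; apply: eq_bigr => i _.
  by rewrite /P nth_cat sl ltn_ord.
have f0 : k`!%:R != 0 :> R by rewrite pnatr_eq0 -lt0n fact_gt0.
by rewrite h; field.
Qed.

Definition metric_row (g1 g2 : R) : 'rV[R]_7 := \row_i (if i == 0 then g1 else g2).

Lemma prod_metric_row g1 g2 l : all (ltn^~ 7) l ->
  \prod_(i <- l) (metric_row g1 g2 0 (inord i))^-1 =
  g1^-1 ^+ count_mem 0%N l * g2^-1 ^+ (size l - count_mem 0%N l).
Proof.
elim: l => [|i l IH] /=; first by rewrite big_nil mulr1.
move=> /andP[i7 l7]; rewrite big_cons IH // mxE -val_eqE /= inordK //.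
have cl : (count_mem 0 l <= size l)%N by apply: count_size.
case: eqP => _ /=; first by rewrite add1n subSS exprS mulrA.
by rewrite add0n subSn // exprS mulrCA.
Qed.

Definition hodge_terms (s : seq (int * seq nat)) :=
  [seq (t.1 * (sort_index (t.2 ++ compl t.2)).1, compl t.2) | t <- s].

(** [n] is the number of factors e^1 (index 0), required to be the same in all terms: then the
    inverse metric contributes one common power g1^-n g2^-(k-n). *)
Definition hodge_wf (k n : nat) (s : seq (int * seq nat)) :=
  all (fun t => [&& size t.2 == k, hodge_perm t.2 & count_mem 0%N t.2 == n]) s.

Lemma hodge_terms_form g1 g2 c k n s Y : g1 != 0 -> g2 != 0 -> (k <= 7)%N -> hodge_wf k n s ->
  hodge (diag_mx (metric_row g1 g2)) c (terms_form k s) Y =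
  c * (g1^-1 ^+ n * g2^-1 ^+ (k - n)) * terms_form (7 - k) (hodge_terms s) Y.
Proof.
move=> g10 g20 k7 /allP ok; rewrite /terms_form hodge_lin mulr_sumr big_map.
apply: eq_big_seq => t /ok /and3P[/eqP st hok /eqP ct].
have al : all (ltn^~ 7) t.2 by case/and4P: hok => _; rewrite all_cat => /andP[].
rewrite hodge_elem_form //; last by move=> i; rewrite mxE; case: ifP.
by rewrite prod_metric_row // st ct intrM /=; ring.
Qed.

End SemOps.

(** * The forms [a e1omega + b VR + c VI] *)

Definition e1omega_terms : seq (int * seq nat) :=
  [:: (1, [:: 0; 1; 2]%N); (1, [:: 0; 3; 4]%N); (1, [:: 0; 5; 6]%N)].
Definition VR_terms : seq (int * seq nat) :=
  [:: (1, [:: 1; 3; 5]%N); (-1, [:: 1; 4; 6]%N); (-1, [:: 2; 3; 6]%N); (-1, [:: 2; 4; 5]%N)].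
Definition VI_terms : seq (int * seq nat) :=
  [:: (1, [:: 2; 3; 5]%N); (-1, [:: 2; 4; 6]%N); (1, [:: 1; 3; 6]%N); (1, [:: 1; 4; 5]%N)].
Definition inv_terms (p : nat) := nth [::] [:: e1omega_terms; VR_terms; VI_terms] p.

Section Phi.
Variable R : realType.
Notation elem_form := (@elem_form R). Notation terms_form := (@terms_form R).

(** Written as a sum over a list so that the linearity lemmas apply to it directly. *)
Definition Phi (a b c : R) : kform R 3 := fun X =>
  \sum_(p <- iota 0 3) nth 0 [:: a; b; c] p * terms_form 3 (inv_terms p) X.

Lemma PhiE a b c X : Phi a b c X = a * e1omega X + b * VR X + c * VI X.
Proof.
rewrite /Phi !big_cons big_nil /terms_form /inv_terms /= !big_cons !big_nil /= /e1omega /VR /VI !elem3E; ring.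
Qed.

(** Half of omega /\ omega. *)
Definition omega2_terms : seq (int * seq nat) :=
  [:: (1, [:: 1; 2; 3; 4]%N); (1, [:: 1; 2; 5; 6]%N); (1, [:: 3; 4; 5; 6]%N)].
Definition e1_terms s : seq (int * seq nat) := [seq (t.1, 0%N :: t.2) | t <- s].

(** Origin of the constants: d e^1 = (2/3) omega and d omega = 0 give 4/3. With z_j = e^{2j} + i
    e^{2j+1} one has d z_j = 4i e^1 /\ z_j, so VR + i VI = z_1 /\ z_2 /\ z_3 has derivative 12i e^1
    /\ (VR + i VI). The certificates concern 3 d, hence 4, -36 and 36. *)
Lemma dext_inv_terms X : [/\ dext (terms_form 3 e1omega_terms) X = 4 / 3 * terms_form 4 omega2_terms X,
  dext (terms_form 3 VR_terms) X = -12 * terms_form 4 (e1_terms VI_terms) X & dext (terms_form 3 VI_terms) X = 12 * terms_form 4 (e1_terms VR_terms) X].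
Proof.
have w p : wf_terms 3 (inv_terms p) by case: p => [|[|[|p]]]; rewrite /inv_terms //= nth_nil.
have ew : eq_terms 4 (dext_terms e1omega_terms) (scale_terms 4 omega2_terms) by vm_compute.
have eR : eq_terms 4 (dext_terms VR_terms) (scale_terms (-36) (e1_terms VI_terms)) by vm_compute.
have eI : eq_terms 4 (dext_terms VI_terms) (scale_terms 36 (e1_terms VR_terms)) by vm_compute.
rewrite (dext_terms_form _ _ _ _ (w 0%N)) (dext_terms_form _ _ _ _ (w 1%N)) (dext_terms_form _ _ _ _ (w 2%N)).
rewrite (terms_form_eq _ _ _ _ _ ew) (terms_form_eq _ _ _ _ _ eR) (terms_form_eq _ _ _ _ _ eI) !terms_form_scale.
by split; field.
Qed.

Lemma dext_Phi a b c : dext (Phi a b c) = fun X =>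
  \sum_(t <- [:: (4 / 3 * a, omega2_terms); (-12 * b, e1_terms VI_terms); (12 * c, e1_terms VR_terms)]) t.1 * terms_form 4 t.2 X.
Proof.
apply: funext => X; rewrite /Phi dext_lin !big_cons !big_nil /=.
by have [-> -> ->] := dext_inv_terms X; ring.
Qed.

(** d exchanges VR and VI up to the factor e^1 and a sign, and the star exchanges them back with the
    matching sign, so * d is diagonal. *)
Lemma hodge_dext_Phi g1 g2 k a b c : g1 != 0 -> g2 != 0 ->
  hodge (diag_mx (metric_row R g1 g2)) k (dext (Phi a b c)) =
  Phi (4 / 3 * k / g2 ^+ 4 * a) (12 * k / (g1 * g2 ^+ 3) * b) (12 * k / (g1 * g2 ^+ 3) * c).
Proof.
move=> g10 g20; apply: funext => Y; rewrite dext_Phi hodge_lin /Phi !big_cons !big_nil /=.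
have hw : hodge_wf 4 0 omega2_terms by vm_compute.
have hR : hodge_wf 4 1 (e1_terms VR_terms) by vm_compute.
have hI : hodge_wf 4 1 (e1_terms VI_terms) by vm_compute.
have ew : eq_terms 3 (hodge_terms omega2_terms) e1omega_terms by vm_compute.
have eR : eq_terms 3 (hodge_terms (e1_terms VR_terms)) VI_terms by vm_compute.
have eI : eq_terms 3 (hodge_terms (e1_terms VI_terms)) (scale_terms (-1) VR_terms) by vm_compute.
rewrite (hodge_terms_form _ _ _ _ _ _ _ _ g10 g20 _ hw) // (hodge_terms_form _ _ _ _ _ _ _ _ g10 g20 _ hR) // (hodge_terms_form _ _ _ _ _ _ _ _ g10 g20 _ hI) //.
rewrite (terms_form_eq _ _ _ _ _ ew) (terms_form_eq _ _ _ _ _ eR) (terms_form_eq _ _ _ _ _ eI).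
by rewrite terms_form_scale /inv_terms /=; field; rewrite g20.
Qed.

(** The star sends e1omega to a multiple of omega^2, closed since omega is. It sends VR and VI to
    multiples of e^1 /\ VI and e^1 /\ VR, closed since d e^1 is a multiple of omega and omega /\ VR
    = omega /\ VI = 0. *)
Lemma dext_hodge_Phi g1 g2 k a b c : g1 != 0 -> g2 != 0 ->
  dext (hodge (diag_mx (metric_row R g1 g2)) k (Phi a b c)) = fun=> 0.
Proof.
move=> g10 g20; apply: funext => X.
have -> : hodge (diag_mx (metric_row R g1 g2)) k (Phi a b c) = fun Y =>
    \sum_(p <- [:: (a * (k * (g1^-1 ^+ 1 * g2^-1 ^+ 2)), hodge_terms e1omega_terms);
      (b * (k * (g1^-1 ^+ 0 * g2^-1 ^+ 3)), hodge_terms VR_terms); (c * (k * (g1^-1 ^+ 0 * g2^-1 ^+ 3)), hodge_terms VI_terms)])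
      p.1 * terms_form 4 p.2 Y.
  apply: funext => Y; rewrite hodge_lin !big_cons !big_nil /inv_terms /=.
  have hw : hodge_wf 3 1 e1omega_terms by vm_compute.
  have hR : hodge_wf 3 0 VR_terms by vm_compute.
  have hI : hodge_wf 3 0 VI_terms by vm_compute.
  by rewrite (hodge_terms_form _ _ _ _ _ _ _ _ g10 g20 _ hw) // (hodge_terms_form _ _ _ _ _ _ _ _ g10 g20 _ hR) // (hodge_terms_form _ _ _ _ _ _ _ _ g10 g20 _ hI) //;
    rewrite !mulrA.
have z s : wf_terms 4 s -> eq_terms 5 (dext_terms s) [::] -> dext (terms_form 4 s) X = 0.
  by move=> w4 /(@terms_form_eq R) e; rewrite dext_terms_form // e /terms_form big_nil mulr0.
have [zw zR zI] : [/\ eq_terms 5 (dext_terms (hodge_terms e1omega_terms)) [::], eq_terms 5 (dext_terms (hodge_terms VR_terms)) [::] & eq_terms 5 (dext_terms (hodge_terms VI_terms)) [::]].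
  by split; vm_compute.
have [ww wR wI] : [/\ wf_terms 4 (hodge_terms e1omega_terms), wf_terms 4 (hodge_terms VR_terms) & wf_terms 4 (hodge_terms VI_terms)] by split; vm_compute.
by rewrite dext_lin !big_cons big_nil /= !z // !mulr0 !addr0.
Qed.

Lemma hodge0 G k n : hodge G k (fun _ : 'I_n -> V R => 0) = fun=> 0.
Proof. by apply: funext => Y; rewrite /hodge big1 ?mulr0 // => f _; rewrite mul0r. Qed.

Lemma dext0 n : dext (fun _ : 'I_n -> V R => 0) = fun=> 0.
Proof. by apply: funext => Y; rewrite /dext big1 // => i _; rewrite big1 // => j _; rewrite mulr0. Qed.

Lemma hlap_Phi g1 g2 k a b c : g1 != 0 -> g2 != 0 ->
  hlap (diag_mx (metric_row R g1 g2)) k (Phi a b c) =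
  Phi ((4 / 3 * k / g2 ^+ 4) ^+ 2 * a) ((12 * k / (g1 * g2 ^+ 3)) ^+ 2 * b)
      ((12 * k / (g1 * g2 ^+ 3)) ^+ 2 * c).
Proof.
move=> g10 g20; apply: funext => X; rewrite /hlap hodge_dext_Phi // hodge_dext_Phi //.
by rewrite dext_hodge_Phi // hodge0 dext0 subr0 !mulrA !expr2 !mulrA.
Qed.

(* The pair (c, l) is now read as the monomial c v_{l_1} .. v_{l_k}. *)
Definition poly_eval (v : nat -> R) (s : seq (int * seq nat)) : R :=
  \sum_(t <- s) t.1%:~R * \prod_(i <- t.2) v i.

Definition poly_collect (s : seq (int * seq nat)) : seq (int * seq nat) :=
  foldr (fun t acc => add_term t.1 (sort leq t.2) acc) [::] s.

Lemma poly_eval_add v c l s :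
  poly_eval v (add_term c l s) = c%:~R * \prod_(i <- l) v i + poly_eval v s.
Proof.
elim: s => [|[d l'] s IH] /=; first by rewrite /poly_eval big_seq1 big_nil addr0.
rewrite /poly_eval in IH *.
case: eqP => [->|_]; rewrite !big_cons /=; first by rewrite intrD; ring.
by rewrite IH; ring.
Qed.

Lemma poly_eval_collect v s : poly_eval v s = poly_eval v (poly_collect s).
Proof.
elim: s => [//|[c l] s IH] /=; rewrite poly_eval_add -IH /poly_eval big_cons /=.
by rewrite (perm_big (sort leq l)) // perm_sym perm_sort.
Qed.

Lemma poly_eval_eq v s1 s2 : all (fun t => t.1 == 0) (poly_collect (s1 ++ scale_terms (-1) s2)) ->
  poly_eval v s1 = poly_eval v s2.
Proof.
move=> /allP z; apply/eqP; rewrite -subr_eq0; apply/eqP.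
have -> : poly_eval v s1 - poly_eval v s2 = poly_eval v (s1 ++ scale_terms (-1) s2).
  rewrite /poly_eval big_cat /= big_map -sumrN; congr (_ + _); apply: eq_bigr => t _ /=.
  by rewrite mulN1r mulrNz mulNr.
by rewrite poly_eval_collect /poly_eval big_seq big1 // => t /z /eqP ->; rewrite mul0r.
Qed.

Definition top_coef (s : seq (int * seq nat)) : int :=
  foldr (fun t acc => (if t.2 == iota 0 7 then t.1 else 0) + acc) 0 (collect s).

Definition is_top_terms s := wf_terms 7 s && all (fun t => (t.2 == iota 0 7) || (t.1 == 0)) (collect s).

Lemma terms_form_top s Z : is_top_terms s ->
  terms_form 7 s Z = (top_coef s)%:~R * \det (\matrix_(i < 7, j < 7) Z i 0 j).
Proof.
move=> /andP[ws]; rewrite terms_form_collect // /top_coef -elem_form_top.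
elim: (collect s) => [|t u IH] /=; first by rewrite /terms_form big_nil mul0r.
move=> /andP[t0 /IH]; rewrite terms_form_cons => ->; rewrite intrD mulrDl; congr (_ + _).
by case: eqP t0 => [->|_ /= /eqP ->]; rewrite ?mul0r.
Qed.

Definition contr_index : seq (nat * nat) := [seq (p, m) | p <- iota 0 3, m <- iota 0 7].
Definition triple_wedge_terms (u : (nat * nat) * (nat * nat)) (p : nat) :=
  wedge_terms (wedge_terms (contr_terms u.1.2 (inv_terms u.1.1)) (contr_terms u.2.2 (inv_terms u.2.1))) (inv_terms p).

(* Variables 0, 1, 2 stand for a, b, c, variable m + 3 for x_m and variable m + 10 for y_m. *)
Definition wedge_cubic : seq (int * seq nat) :=
  [seq (top_coef (triple_wedge_terms u p), [:: u.1.1; u.2.1; p; u.1.2 + 3; u.2.2 + 10]%N)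
    | u <- [seq (i, j) | i <- contr_index, j <- contr_index], p <- iota 0 3].

Definition metric_cubic : seq (int * seq nat) :=
  [:: (6, [:: 0; 0; 0; 3; 10]%N) &
    flatten [seq [:: (6, [:: 0; 1; 1; m + 3; m + 10]%N); (6, [:: 0; 2; 2; m + 3; m + 10]%N)]
      | m <- iota 1 6]].

Lemma triple_wedge_terms_ok :
  all (fun u => [&& wf_terms 4 (wedge_terms (contr_terms u.1.2 (inv_terms u.1.1)) (contr_terms u.2.2 (inv_terms u.2.1))),
         [&& u.1.1 < 3, u.2.1 < 3 & u.1.2 < 7]%N
       & all (fun p => [&& wf_terms 3 (inv_terms p), (p < 3)%N & is_top_terms (triple_wedge_terms u p)]) (iota 0 3)])
    [seq (i, j) | i <- contr_index, j <- contr_index].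
Proof. by vm_compute. Qed.

Lemma wf_contr_index : all (fun i => wf_terms 2 (contr_terms i.2 (inv_terms i.1))) contr_index.
Proof. by vm_compute. Qed.

(** All 21 * 21 * 3 triple products are added up as one polynomial in a, b, c, x, y; the mixed
    monomials x_m y_n with m distinct from n cancel, which is why the metric is diagonal. *)
Lemma wedge_cubicE : all (fun t => t.1 == 0) (poly_collect (wedge_cubic ++ scale_terms (-1) metric_cubic)).
Proof. by vm_compute. Qed.

Lemma contr_Phi x a b c : contr x (Phi a b c) = fun Y =>
  \sum_(i <- contr_index) (nth 0 [:: a; b; c] i.1 * x 0 (inord i.2)) * terms_form 2 (contr_terms i.2 (inv_terms i.1)) Y.
Proof.
apply: funext => Y; rewrite /Phi contr_lin /contr_index big_allpairs_dep.
have w p : wf_terms 3 (inv_terms p) by case: p => [|[|[|p]]]; rewrite /inv_terms //= nth_nil.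
apply: eq_bigr => p _; rewrite contr_terms_form // mulr_sumr -[iota 0 7]/(index_iota 0 7) big_mkord.
by apply: eq_bigr => m _; rewrite inord_val mulrA.
Qed.

(** The metric times its volume coefficient, which is what the 3-form determines directly. *)
Definition metric_form (a b c : R) (x y : V R) : R :=
  a ^+ 3 * (x 0 (inord 0) * y 0 (inord 0))
  + a * (b ^+ 2 + c ^+ 2) * \sum_(m <- iota 1 6) x 0 (inord m) * y 0 (inord m).

Lemma wedge_Phi a b c x y Z :
  wedge (wedge (contr x (Phi a b c)) (contr y (Phi a b c))) (Phi a b c) Z =
  6 * metric_form a b c x y * \det (\matrix_(i < 7, j < 7) Z i 0 j).
Proof.
pose cf p : R := nth 0 [:: a; b; c] p.
have -> : wedge (contr x (Phi a b c)) (contr y (Phi a b c)) = fun Z' =>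
  \sum_(u <- [seq (i, j) | i <- contr_index, j <- contr_index])
    ((cf u.1.1 * x 0 (inord u.1.2)) * (cf u.2.1 * y 0 (inord u.2.2))) *
     terms_form 4 (wedge_terms (contr_terms u.1.2 (inv_terms u.1.1)) (contr_terms u.2.2 (inv_terms u.2.1))) Z'.
  apply: funext => Z'; rewrite !contr_Phi wedge_lin [RHS]big_allpairs_dep.
  apply: eq_big_seq => i /(allP wf_contr_index) wi; apply: eq_big_seq => j /(allP wf_contr_index) wj.
  by rewrite wedge_terms_form.
pose v n : R := if (n < 3)%N then cf n else if (n < 10)%N then x 0 (inord (n - 3))
  else y 0 (inord (n - 10)).
have -> : 6 * metric_form a b c x y = poly_eval v metric_cubic.
  rewrite /poly_eval /metric_cubic /= !big_cons !big_nil /v /cf /= /metric_form /= !big_cons !big_nil.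
  rewrite -[3%N]/(0 + 3)%N -[10%N]/(0 + 10)%N !addnK; ring.
rewrite -(poly_eval_eq _ _ _ wedge_cubicE) wedge_lin /poly_eval [in RHS]big_allpairs_dep mulr_suml.
apply: eq_big_seq => u ur; rewrite mulr_suml; apply: eq_big_seq => p p3.
have /and3P[w4 /and3P[u1 u2 u3] /allP/(_ p p3)/and3P[w3 p_lt3 ok]] := allP triple_wedge_terms_ok u ur.
rewrite wedge_terms_form // terms_form_top // !big_cons big_nil /= mulr1.
have -> : v u.1.1 = cf u.1.1 by rewrite /v u1.
have -> : v u.2.1 = cf u.2.1 by rewrite /v u2.
have -> : v p = cf p by rewrite /v p_lt3.
have -> : v (u.1.2 + 3)%N = x 0 (inord u.1.2).
  by rewrite /v ltnNge leq_addl /= (ltn_add2r 3 _ 7) u3 addnK.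
have -> : v (u.2.2 + 10)%N = y 0 (inord u.2.2).
  by rewrite /v ltnNge (leq_trans _ (leq_addl _ _)) //= ltnNge leq_addl /= addnK.
rewrite -/(triple_wedge_terms u p) -/(cf p); move: (\det _) (_%:~R) => ? ?; ring.
Qed.

End Phi.

(** * Invariance under SU(3) *)

Lemma det3E (T : comNzRingType) (A : 'M[T]_3) :
  let i0 := inord 0 in let i1 := inord 1 in let i2 := inord 2 in
  \det A = A i0 i0 * (A i1 i1 * A i2 i2 - A i1 i2 * A i2 i1)
         - A i0 i1 * (A i1 i0 * A i2 i2 - A i1 i2 * A i2 i0)
         + A i0 i2 * (A i1 i0 * A i2 i1 - A i1 i1 * A i2 i0).
Proof.
move=> i0 i1 i2; pose a (i j : nat) := A (inord i) (inord j).
have AE i j : A i j = a i j by rewrite /a !inord_val.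
rewrite (expand_det_row _ ord0) !big_ord_recl big_ord0 /cofactor.
rewrite ![\det (row' _ _)](expand_det_row _ ord0) !big_ord_recl !big_ord0 /cofactor !det_mx11 !mxE.
rewrite !AE !inordK //= /bump /=; ring.
Qed.

Section Invariance.
Variable R : realType.
Notation elem_form := (@elem_form R). Notation terms_form := (@terms_form R).
Local Notation C := (C R). Notation zvec := (@zvec R).

Lemma elem3_expand i j k (X : 'I_3 -> V R) :
  let x := X (inord 0) in let y := X (inord 1) in let z := X (inord 2) in
  let i := inord i in let j := inord j in let k := inord k in
  elem3 i j k X = x 0 i * (y 0 j * z 0 k - y 0 k * z 0 j) - x 0 j * (y 0 i * z 0 k - y 0 k * z 0 i)
    + x 0 k * (y 0 i * z 0 j - y 0 j * z 0 i).
Proof. by move=> x y z ? ? ?; rewrite /elem3 det3E !mxE !inordK. Qed.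

(** omega as the imaginary part of the Hermitian product on C^3, so that unitarity alone gives its
    invariance. *)
Definition omega_form (x y : V R) : R := complex.Im ((map_mx Num.conj (zvec x)^T *m zvec y) 0 0).

Lemma omega_formE (x y : V R) : omega_form x y =
  x 0 (inord 1) * y 0 (inord 2) - x 0 (inord 2) * y 0 (inord 1)
  + (x 0 (inord 3) * y 0 (inord 4) - x 0 (inord 4) * y 0 (inord 3))
  + (x 0 (inord 5) * y 0 (inord 6) - x 0 (inord 6) * y 0 (inord 5)).
Proof. by rewrite /omega_form mxE !big_ord_recl big_ord0 !mxE /=; ring. Qed.

Lemma omega_form_Ad (A : 'M[C]_3) x y : SU3 A -> omega_form (Ad A x) (Ad A y) = omega_form x y.
Proof.
have adj (z w : 'cV[C]_3) : SU3 A ->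
    map_mx Num.conj (A *m z)^T *m (A *m w) = map_mx Num.conj z^T *m w.
  by move=> [AA _]; rewrite trmx_mul map_mxM -mulmxA [X in _ *m X]mulmxA -(map_trmx _ A) AA mul1mx.
move=> hA; apply: (etrans (congr2 (fun z w => complex.Im ((map_mx Num.conj z^T *m w) 0 0))
  (zvec_Ad R A x hA) (zvec_Ad R A y hA))).
by rewrite adj.
Qed.

Lemma e1omegaE X : @e1omega R X =
  X (inord 0) 0 0 * omega_form (X (inord 1)) (X (inord 2))
  - X (inord 1) 0 0 * omega_form (X (inord 0)) (X (inord 2))
  + X (inord 2) 0 0 * omega_form (X (inord 0)) (X (inord 1)).
Proof.
have -> : (0 : 'I_7) = inord 0 by apply: val_inj; rewrite /= inordK.
by rewrite /e1omega /ix !elem3_expand !omega_formE; ring.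
Qed.

Lemma e1omega_Ad (A : 'M[C]_3) X : SU3 A -> @e1omega R (fun t => Ad A (X t)) = e1omega X.
Proof.
move=> hA; apply: (etrans (e1omegaE _)); apply: (etrans _ (esym (e1omegaE _))).
have cong (p p' q q' r r' a a' b b' c c' : R) : p = p' -> q = q' -> r = r' ->
    a = a' -> b = b' -> c = c' -> p * a - q * b + r * c = p' * a' - q' * b' + r' * c'.
  by do 6 move=> ->.
by apply: cong; [apply: Ad0 | apply: Ad0 | apply: Ad0 | apply: omega_form_Ad..].
Qed.

Definition zvec_mx (X : 'I_3 -> V R) : 'M[C]_3 := \matrix_(r, s) zvec (X r) s 0.

(** VR + i VI is the complex volume form of C^3; its invariance is then the condition det A = 1. *)
Lemma det_zvec_mxE X : complex.Re (\det (zvec_mx X)) = VR X /\ complex.Im (\det (zvec_mx X)) = VI X.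
Proof.
rewrite /VR /VI /ix !elem3_expand det3E !mxE !inordK //=.
by split; ring.
Qed.

Lemma det_zvec_mx_Ad (A : 'M[C]_3) X : SU3 A -> \det (zvec_mx (fun t => Ad A (X t))) = \det (zvec_mx X).
Proof.
move=> hA; have -> : zvec_mx (fun t => Ad A (X t)) = zvec_mx X *m A^T.
  apply/matrixP => r s; rewrite mxE zvec_Ad // !mxE; apply: eq_bigr => k _.
  by rewrite !mxE mulrC.
by rewrite det_mulmx det_tr; case: hA => _ ->; rewrite mulr1.
Qed.

Lemma Phi_invariant a b c : su3_invariant (Phi R a b c).
Proof.
move=> A hA X; rewrite 2!PhiE e1omega_Ad //.
have [<- <-] := det_zvec_mxE X; have [<- <-] := det_zvec_mxE (fun t => Ad A (X t)).
by rewrite det_zvec_mx_Ad.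
Qed.

End Invariance.

(** * Values of 3-forms on basis triples, and explicit elements of SU(3) *)

Section Forms.
Variable R : realType.
Notation elem_form := (@elem_form R). Notation terms_form := (@terms_form R).
Notation Phi := (Phi R).
Local Notation C := (C R). Notation zvec := (@zvec R).

Lemma is_form_elem_form k l : is_form (elem_form k l).
Proof.
split=> [X i a u v | X i j ij Xij]; last first.
  by apply: (determinant_alternate ij) => s; rewrite !mxE Xij.
rewrite /elem_form (@determinant_multilinear _ _ _
  (\matrix_(r < k, s < k) (if r == i then u else X r) 0 (inord (nth 0%N l s)))
  (\matrix_(r < k, s < k) (if r == i then v else X r) 0 (inord (nth 0%N l s))) i a 1) ?mul1r //.
- by apply/rowP => s; rewrite !mxE !eqxx !mxE mul1r.
- by apply/matrixP => r s; rewrite !mxE eq_sym (negbTE (neq_lift _ _)).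
- by apply/matrixP => r s; rewrite !mxE eq_sym (negbTE (neq_lift _ _)).
Qed.

Lemma is_form_lin k (I : Type) (r : seq I) (c : I -> R) (f : I -> kform R k) :
  (forall i, is_form (f i)) -> is_form (fun X => \sum_(i <- r) c i * f i X).
Proof.
move=> ff; split=> [X i a u v|X i j ij Xij].
  rewrite mulr_sumr -big_split /=; apply: eq_bigr => t _.
  by have [-> _] := ff t; ring.
by rewrite big1 // => t _; have [_ /(_ X i j ij Xij) ->] := ff t; rewrite mulr0.
Qed.

Lemma is_form_Phi a b c : is_form (Phi a b c).
Proof. by apply: is_form_lin => p; apply: is_form_lin => t; apply: is_form_elem_form. Qed.

Definition triple (u v w : V R) : 'I_3 -> V R := fun t => nth 0 [:: u; v; w] t.
Definition e_ (i : nat) : V R := delta_mx 0 (inord i).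

Lemma triple_eta (X : 'I_3 -> V R) : X = triple (X (inord 0)) (X (inord 1)) (X (inord 2)).
Proof.
apply: funext; apply: ord3_ind; rewrite /triple inordK //=.
Qed.

Section OneForm.
Variable h : kform R 3.
Hypothesis hf : is_form h.

Lemma form_lin1 a u v x y : h (triple (a *: u + v) x y) = a * h (triple u x y) + h (triple v x y).
Proof.
have [/(_ (triple 0 x y) (inord 0) a u v) E _] := hf.
by do [congr (_ = _ * _ + _); congr h; apply: funext; apply: ord3_ind;
  rewrite /triple ?eqxx ?inord3_neq ?inordK] in E.
Qed.

Lemma form_lin2 a u v x y : h (triple x (a *: u + v) y) = a * h (triple x u y) + h (triple x v y).
Proof.
have [/(_ (triple x 0 y) (inord 1) a u v) E _] := hf.
by do [congr (_ = _ * _ + _); congr h; apply: funext; apply: ord3_ind;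
  rewrite /triple ?eqxx ?inord3_neq ?inordK] in E.
Qed.

Lemma form_lin3 a u v x y : h (triple x y (a *: u + v)) = a * h (triple x y u) + h (triple x y v).
Proof.
have [/(_ (triple x y 0) (inord 2) a u v) E _] := hf.
by do [congr (_ = _ * _ + _); congr h; apply: funext; apply: ord3_ind;
  rewrite /triple ?eqxx ?inord3_neq ?inordK] in E.
Qed.

Lemma form_alt12 u v : h (triple u u v) = 0.
Proof.
have [_ /(_ (triple u u v) (inord 0) (inord 1))] := hf; apply; first by rewrite inord3_neq.
by rewrite /triple !inordK.
Qed.

Lemma form_alt23 u v : h (triple v u u) = 0.
Proof.
have [_ /(_ (triple v u u) (inord 1) (inord 2))] := hf; apply; first by rewrite inord3_neq.
by rewrite /triple !inordK.
Qed.

Lemma form_swap12 u v w : h (triple u v w) = - h (triple v u w).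
Proof.
have := form_alt12 (1 *: u + v) w; rewrite form_lin1 !form_lin2 !form_alt12.
by rewrite !mul1r add0r addr0 => /eqP; rewrite addr_eq0 => /eqP.
Qed.

Lemma form_swap23 u v w : h (triple u v w) = - h (triple u w v).
Proof.
have := form_alt23 (1 *: v + w) u; rewrite form_lin2 !form_lin3 !form_alt23.
by rewrite !mul1r add0r addr0 => /eqP; rewrite addr_eq0 => /eqP.
Qed.

Lemma lin_eq0 (g : V R -> R) : (forall a u v, g (a *: u + v) = a * g u + g v) ->
  (forall i, (i < 7)%N -> g (e_ i) = 0) -> forall x, g x = 0.
Proof.
move=> gl g0 x.
have g00 : g 0 = 0 by have := gl 1 0 0; rewrite scaler0 addr0 mul1r => /eqP; rewrite -subr_eq0 opprD addNKr oppr_eq0 => /eqP.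
rewrite [x]row_sum_delta; elim/big_rec: _ => // i y _ gy.
by rewrite gl gy -(inord_val i) [g _]g0 // mulr0 addr0.
Qed.

Lemma form_eq0 : (forall i j k, (i < j < k)%N -> (k < 7)%N -> h (triple (e_ i) (e_ j) (e_ k)) = 0) ->
  h = fun=> 0.
Proof.
move=> h0; apply: funext => X; rewrite (triple_eta X).
apply: (lin_eq0 (fun u => h (triple u _ _))) => [*|i i7]; first exact: form_lin1.
apply: (lin_eq0 (fun u => h (triple _ u _))) => [*|j j7]; first exact: form_lin2.
apply: (lin_eq0 (fun u => h (triple _ _ u))) => [*|k k7]; first exact: form_lin3.
wlog ij : i j i7 j7 / (i <= j)%N => [wl|].
  by case: (leqP i j) => ij; [apply: wl | rewrite form_swap12 wl ?oppr0 // ltnW].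
move: ij; rewrite leq_eqVlt => /predU1P[->|ij]; first exact: form_alt12.
case: (ltngtP j k) => [jk|kj|->]; last exact: form_alt23.
  by apply: h0; rewrite ?ij.
case: (ltngtP i k) => [ik|ki|->].
- by rewrite form_swap23 h0 ?oppr0 // ik.
- by rewrite form_swap23 form_swap12 h0 ?oppr0 // ki.
by rewrite form_swap23 form_alt12 oppr0.
Qed.

End OneForm.

Definition diag3 (u v w : C) : 'M[C]_3 := diag_mx (\row_j nth 0 [:: u; v; w] j).

Lemma SU3_diag3 u v w : conjc u * u = 1 -> conjc v * v = 1 -> conjc w * w = 1 ->
  u * v * w = 1 -> SU3 (diag3 u v w).
Proof.
move=> hu hv hw huvw; split; last first.
  by rewrite det_diag !big_ord_recl big_ord0 !mxE /= mulr1 mulrA.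
rewrite map_diag_mx tr_diag_mx mulmx_diag -diag_const_mx; congr diag_mx.
by apply/rowP; apply: ord3_ind; rewrite !mxE !inordK.
Qed.

Definition cyc3 : 'M[C]_3 := \matrix_(r, c) (r == c.+1 %% 3 :> nat)%N%:R.

Lemma SU3_cyc3 : SU3 cyc3.
Proof.
split; last by rewrite det3E !mxE !inordK //= ; ring.
apply/matrixP; apply: ord3_ind; apply: ord3_ind;
  by rewrite !mxE !big_ord_recl big_ord0 !mxE /= ?eqxx ?inord3_neq !inordK //= rmorph0 rmorph1; ring.
Qed.

Lemma zvec_ext (x y : V R) : x 0 0 = y 0 0 -> zvec x = zvec y -> x = y.
Proof.
move=> h0 /colP hz; apply/rowP; have re j := congr1 (@complex.Re R) (hz j).
have im j := congr1 (@complex.Im R) (hz j).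
have := (re (inord 0), re (inord 1), re (inord 2), im (inord 0), im (inord 1), im (inord 2)).
rewrite !mxE !inordK //= => -[[[[[h1 h3] h5] h2] h4] h6] i; rewrite -(inord_val i).
case: i => -[|[|[|[|[|[|[|//]]]]]]] //= _.
by have -> : inord 0 = 0 :> 'I_7 by apply: val_inj; rewrite /= inordK.
Qed.

Lemma inord_eq n a b : (a < n.+1)%N -> (b < n.+1)%N ->
  (inord a == inord b :> 'I_n.+1) = (a == b).
Proof. by move=> ha hb; rewrite -val_eqE /= !inordK. Qed.

Lemma e_E i j : (i < 7)%N -> (j < 7)%N -> e_ i 0 (inord j) = (j == i)%:R.
Proof. by move=> hi hj; rewrite mxE eqxx inord_eq. Qed.

Lemma ord0E n : 0 = inord 0 :> 'I_n.+1.
Proof. by apply: val_inj; rewrite /= inordK. Qed.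

Lemma zvec_e0 : zvec (e_ 0) = 0.
Proof.
by apply/colP; apply: ord3_ind; rewrite zvecE // !e_E // mxE.
Qed.

Lemma zvec_odd j : (j < 3)%N -> zvec (e_ j.*2.+1) = \col_k (k == j :> nat)%:R.
Proof.
by case: j => [|[|[|//]]] _; apply/colP; apply: ord3_ind; rewrite zvecE // !e_E // mxE inordK.
Qed.

Lemma zvec_even j : (j < 3)%N -> zvec (e_ j.*2.+2) = \col_k (Complex 0 (k == j :> nat)%:R).
Proof.
by case: j => [|[|[|//]]] _; apply/colP; apply: ord3_ind; rewrite zvecE // !e_E // mxE inordK.
Qed.

Lemma Ad_e0 (A : 'M[C]_3) : SU3 A -> Ad A (e_ 0) = e_ 0.
Proof. by move=> hA; apply: zvec_ext; rewrite ?Ad0 // zvec_Ad // zvec_e0 mulmx0. Qed.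

Lemma zvecD x y : zvec (x + y) = zvec x + zvec y.
Proof. by apply/colP => j; rewrite !mxE. Qed.

Lemma zvecZ a x : zvec (a *: x) = Complex a 0 *: zvec x.
Proof. by apply/colP => j; rewrite !mxE; apply: complex_ext => /=; ring. Qed.

Lemma Ad_diag3 u v w j : SU3 (diag3 u v w) -> (j < 3)%N ->
  let c := nth 0 [:: u; v; w] j in
  Ad (diag3 u v w) (e_ j.*2.+1) =
    complex.Re c *: e_ j.*2.+1 + complex.Im c *: e_ j.*2.+2 /\
  Ad (diag3 u v w) (e_ j.*2.+2) =
    - complex.Im c *: e_ j.*2.+1 + complex.Re c *: e_ j.*2.+2.
Proof.
move=> hA j3 c; have lt0 i : (i < 6)%N -> e_ i.+1 0 0 = 0.
  by move=> i6; rewrite (ord0E 6) e_E.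
have j6 : (j.*2.+1 < 6)%N by case: (j) j3 => [|[|[|]]].
have D0 a b x y : (a *: x + b *: y : V R) 0 0 = a * x 0 0 + b * y 0 0 by rewrite !mxE.
split; apply: zvec_ext.
- by rewrite Ad0 // D0 !lt0 ?(ltnW j6) // !mulr0 addr0.
- rewrite zvec_Ad // mul_diag_mx zvecD !zvecZ zvec_odd // zvec_even //.
  apply/colP => k; rewrite !mxE; case: eqP => [->|_]; last by rewrite !mulr0 addr0.
  by rewrite -/c; case: c => p q; apply: complex_ext => /=; ring.
- by rewrite Ad0 // D0 !lt0 ?(ltnW j6) // !mulr0 addr0.
rewrite zvec_Ad // mul_diag_mx zvecD !zvecZ zvec_odd // zvec_even //.
apply/colP => k; rewrite !mxE; case: eqP => [->|_]; last by rewrite !mulr0 addr0.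
by rewrite -/c; case: c => p q; apply: complex_ext => /=; ring.
Qed.

Lemma Ad_cyc3 j : (j < 3)%N ->
  Ad cyc3 (e_ j.*2.+1) = e_ (j.+1 %% 3)%N.*2.+1 /\
  Ad cyc3 (e_ j.*2.+2) = e_ (j.+1 %% 3)%N.*2.+2.
Proof.
move=> j3; have m3 : (j.+1 %% 3 < 3)%N by rewrite ltn_mod.
have lt0 i : (i < 6)%N -> e_ i.+1 0 0 = 0.
  by move=> i6; rewrite (ord0E 6) e_E.
have lt6 i : (i < 3)%N -> (i.*2.+1 < 6)%N by case: i => [|[|[|]]].
split; apply: zvec_ext.
- by rewrite Ad0 ?lt0 ?(ltnW (lt6 _ _)) //; exact: SU3_cyc3.
- rewrite zvec_Ad; last exact: SU3_cyc3.
  rewrite !zvec_odd //; apply/colP => k; rewrite mxE (bigD1 (inord j)) //= !mxE inordK // eqxx mulr1.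
  by rewrite big1 ?addr0 // => i; rewrite -val_eqE /= inordK // !mxE => /negbTE ->; rewrite mulr0.
- by rewrite Ad0 ?lt0 ?lt6 //; exact: SU3_cyc3.
rewrite zvec_Ad; last exact: SU3_cyc3.
rewrite !zvec_even //; apply/colP => k; rewrite mxE (bigD1 (inord j)) //= !mxE inordK // eqxx.
rewrite big1 ?addr0; last by move=> i; rewrite -val_eqE /= inordK // !mxE => /negbTE ->; rewrite mulr0.
by apply: complex_ext; case: eqP => /= _; ring.
Qed.

End Forms.

(** * Classification of the invariant forms *)

Section Classify.
Variable R : realType.
Notation Phi := (Phi R). Notation e_ := (@e_ R). Notation triple := (@triple R).
Local Notation C := (C R).

Lemma form_scale (h : kform R 3) a b c u v w : is_form h ->
  h (triple (a *: u) (b *: v) (c *: w)) = a * b * c * h (triple u v w).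
Proof.
move=> hf.
have s1 x y : h (triple 0 x y) = 0.
  by have := form_lin1 _ _ hf 1 0 0 x y; rewrite scaler0 addr0 mul1r; lra.
have s2 x y : h (triple x 0 y) = 0.
  by have := form_lin2 _ _ hf 1 0 0 x y; rewrite scaler0 addr0 mul1r; lra.
have s3 x y : h (triple x y 0) = 0.
  by have := form_lin3 _ _ hf 1 0 0 x y; rewrite scaler0 addr0 mul1r; lra.
rewrite -[a *: u]addr0 -[b *: v]addr0 -[c *: w]addr0.
by rewrite form_lin1 // form_lin2 // form_lin3 // !(s1, s2, s3) !addr0 !mulrA.
Qed.

Lemma is_form_sub k (f g : kform R k) : is_form f -> is_form g -> is_form (fun X => f X - g X).
Proof.
move=> [lf af] [lg ag]; split=> [X i a u v|X i j ij Xij]; first by rewrite lf lg; ring.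
by rewrite (af X i j ij Xij) (ag X i j ij Xij) subr0.
Qed.

Lemma Phi_coef a b c : [/\ Phi a b c (triple (e_ 0) (e_ 1) (e_ 2)) = a,
  Phi a b c (triple (e_ 1) (e_ 3) (e_ 5)) = b & Phi a b c (triple (e_ 2) (e_ 3) (e_ 5)) = c].
Proof.
rewrite !PhiE /e1omega /VR /VI /ix !elem3_expand /triple !inordK //= !e_E //=.
by split; ring.
Qed.

Lemma Phi_inj a b c a' b' c' : Phi a b c = Phi a' b' c' -> [/\ a = a', b = b' & c = c'].
Proof.
move=> e; have [ha hb hc] := Phi_coef a b c; have [ha' hb' hc'] := Phi_coef a' b' c'.
by rewrite e in ha hb hc; split; congruence.
Qed.

Section Vanish.
Variable h : kform R 3.
Hypotheses (hf : is_form h) (hi : su3_invariant h).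
Let F i j k := h (triple (e_ i) (e_ j) (e_ k)).

Lemma invariant_triple A u v w : SU3 A -> h (triple (Ad A u) (Ad A v) (Ad A w)) = h (triple u v w).
Proof.
move=> hA; rewrite -[RHS](hi A hA); congr h; apply: funext; apply: ord3_ind;
  by rewrite /triple !inordK.
Qed.

Lemma signed_perm A (p : nat -> nat) (s : nat -> R) i j k : SU3 A ->
  (forall n, (n < 7)%N -> Ad A (e_ n) = s n *: e_ (p n)) ->
  (i < 7)%N -> (j < 7)%N -> (k < 7)%N ->
  F i j k = s i * s j * s k * F (p i) (p j) (p k).
Proof. by move=> hA hp i7 j7 k7; rewrite /F -(invariant_triple A) // !hp // form_scale. Qed.

(* diag(i, -i, 1) and diag(i, 1, -i) act on the basis as signed permutations; their squares as signs *)
Definition pT12 n := nth 0%N [:: 0; 2; 1; 4; 3; 5; 6]%N n.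
Definition sT12 n : R := nth 0 [:: 1; 1; -1; -1; 1; 1; 1] n.
Definition pT13 n := nth 0%N [:: 0; 2; 1; 3; 4; 6; 5]%N n.
Definition sT13 n : R := nth 0 [:: 1; 1; -1; 1; 1; -1; 1] n.
Definition pcyc n := nth 0%N [:: 0; 3; 4; 5; 6; 1; 2]%N n.

Lemma Ad_signed u v w n : SU3 (diag3 R u v w) -> (n < 7)%N ->
  Ad (diag3 R u v w) (e_ n) = if n == 0%N then e_ 0 else
   let c := nth 0 [:: u; v; w] n.-1./2 in
   if odd n then complex.Re c *: e_ n + complex.Im c *: e_ n.+1
   else - complex.Im c *: e_ n.-1 + complex.Re c *: e_ n.
Proof.
move=> hA; case: n => [|[|[|[|[|[|[|//]]]]]]] _ /=; first exact: Ad_e0.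
- by have [-> _] := @Ad_diag3 R u v w 0 hA isT.
- by have [_ ->] := @Ad_diag3 R u v w 0 hA isT.
- by have [-> _] := @Ad_diag3 R u v w 1 hA isT.
- by have [_ ->] := @Ad_diag3 R u v w 1 hA isT.
- by have [-> _] := @Ad_diag3 R u v w 2 hA isT.
- by have [_ ->] := @Ad_diag3 R u v w 2 hA isT.
Qed.

Lemma SU3_T12 : SU3 (diag3 R (Complex 0 1) (Complex 0 (-1)) 1).
Proof. by apply: SU3_diag3; apply: complex_ext => /=; ring. Qed.

Lemma SU3_T13 : SU3 (diag3 R (Complex 0 1) 1 (Complex 0 (-1))).
Proof. by apply: SU3_diag3; apply: complex_ext => /=; ring. Qed.

Lemma F_T12 i j k : (i < 7)%N -> (j < 7)%N -> (k < 7)%N ->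
  F i j k = sT12 i * sT12 j * sT12 k * F (pT12 i) (pT12 j) (pT12 k).
Proof.
apply: signed_perm SU3_T12 _ => n n7; rewrite Ad_signed //; last exact: SU3_T12.
case: n n7 => [|[|[|[|[|[|[|//]]]]]]] _; rewrite /sT12 /pT12 /=.
all: by rewrite ?opprK ?oppr0 ?scale1r ?scale0r ?scaleN1r ?addr0 ?add0r.
Qed.

Lemma F_T13 i j k : (i < 7)%N -> (j < 7)%N -> (k < 7)%N ->
  F i j k = sT13 i * sT13 j * sT13 k * F (pT13 i) (pT13 j) (pT13 k).
Proof.
apply: signed_perm SU3_T13 _ => n n7; rewrite Ad_signed //; last exact: SU3_T13.
case: n n7 => [|[|[|[|[|[|[|//]]]]]]] _; rewrite /sT13 /pT13 /=.
all: by rewrite ?opprK ?oppr0 ?scale1r ?scale0r ?scaleN1r ?addr0 ?add0r.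
Qed.

Lemma F_cyc i j k : (i < 7)%N -> (j < 7)%N -> (k < 7)%N ->
  F i j k = F (pcyc i) (pcyc j) (pcyc k).
Proof.
move=> i7 j7 k7; rewrite -[RHS]mul1r -[X in X * _](mulr1 1) -[X in X * _](mulr1 (1 * 1)).
apply: (signed_perm _ pcyc (fun=> 1) _ _ _ (SU3_cyc3 R)) => // n n7; rewrite scale1r.
case: n n7 => [|[|[|[|[|[|[|//]]]]]]] _; rewrite /pcyc /=.
- exact/Ad_e0/SU3_cyc3.
- by have [-> _] := @Ad_cyc3 R 0 isT.
- by have [_ ->] := @Ad_cyc3 R 0 isT.
- by have [-> _] := @Ad_cyc3 R 1 isT.
- by have [_ ->] := @Ad_cyc3 R 1 isT.
- by have [-> _] := @Ad_cyc3 R 2 isT.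
- by have [_ ->] := @Ad_cyc3 R 2 isT.
Qed.

(** The squares diag(-1, -1, 1) and diag(-1, 1, -1) kill all basis triples except eleven: 0 with one
    of the pairs 12, 34, 56, and one index from each pair. The cyclic permutation links the first
    three; the other eight are linked to 135 or 235 by the two diagonal matrices. *)
Lemma invariant_eq0 : F 0 1 2 = 0 -> F 1 3 5 = 0 -> F 2 3 5 = 0 -> h = fun=> 0.
Proof.
move=> F012 F135 F235; apply: form_eq0 => // i j k /andP[ij jk] k7.
rewrite -/(F i j k).
have F034 : F 0 3 4 = 0 by rewrite -F012 [RHS]F_cyc.
have F056 : F 0 5 6 = 0 by rewrite -F034 [RHS]F_cyc.
have F245 : F 2 4 5 = 0 by have := F_T12 1 3 5 isT isT isT; rewrite /sT12 /pT12 /= F135; lra.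
have F145 : F 1 4 5 = 0 by have := F_T12 2 3 5 isT isT isT; rewrite /sT12 /pT12 /= F235; lra.
have F236 : F 2 3 6 = 0 by have := F_T13 1 3 5 isT isT isT; rewrite /sT13 /pT13 /= F135; lra.
have F136 : F 1 3 6 = 0 by have := F_T13 2 3 5 isT isT isT; rewrite /sT13 /pT13 /= F235; lra.
have F146 : F 1 4 6 = 0 by have := F_T12 2 3 6 isT isT isT; rewrite /sT12 /pT12 /= F236; lra.
have F246 : F 2 4 6 = 0 by have := F_T12 1 3 6 isT isT isT; rewrite /sT12 /pT12 /= F136; lra.
have lt7 n : (n < 7)%N -> (pT12 n < 7)%N by case: n => [|[|[|[|[|[|[|]]]]]]].
have lt7' n : (n < 7)%N -> (pT13 n < 7)%N by case: n => [|[|[|[|[|[|[|]]]]]]].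
have pT12K n : (n < 7)%N -> pT12 (pT12 n) = n by case: n => [|[|[|[|[|[|[|]]]]]]].
have pT13K n : (n < 7)%N -> pT13 (pT13 n) = n by case: n => [|[|[|[|[|[|[|]]]]]]].
(* Two applications return the same triple with a sign; when the sign is -1, the final [lra]
   concludes F = 0. *)
have S12 a b c : (a < 7)%N -> (b < 7)%N -> (c < 7)%N -> F a b c =
    (sT12 a * sT12 (pT12 a)) * (sT12 b * sT12 (pT12 b)) * (sT12 c * sT12 (pT12 c)) * F a b c.
  move=> a7 b7 c7; rewrite {1}F_T12 // F_T12; try by apply: lt7.
  by rewrite !pT12K //; ring.
have S13 a b c : (a < 7)%N -> (b < 7)%N -> (c < 7)%N -> F a b c =
    (sT13 a * sT13 (pT13 a)) * (sT13 b * sT13 (pT13 b)) * (sT13 c * sT13 (pT13 c)) * F a b c.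
  move=> a7 b7 c7; rewrite {1}F_T13 // F_T13; try by apply: lt7'.
  by rewrite !pT13K //; ring.
have j6 : (j < 6)%N by apply: leq_trans jk _.
have i5 : (i < 5)%N by apply: leq_trans ij _.
case: i i5 ij => [|[|[|[|[|//]]]]] _; case: j j6 jk => [|[|[|[|[|[|//]]]]]] _;
  case: k k7 => [|[|[|[|[|[|[|//]]]]]]] _ // _ _ //;
  match goal with |- F ?i ?j ?k = 0 =>
    have := S12 i j k isT isT isT; have := S13 i j k isT isT isT end;
  rewrite /sT12 /pT12 /sT13 /pT13 /=; lra.
Qed.

End Vanish.

Lemma invariant_form_Phi phi : is_form phi -> su3_invariant phi ->
  phi = Phi (phi (triple (e_ 0) (e_ 1) (e_ 2))) (phi (triple (e_ 1) (e_ 3) (e_ 5)))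
            (phi (triple (e_ 2) (e_ 3) (e_ 5))).
Proof.
move=> hf hi; set a := phi _; set b := phi _; set c := phi _.
have [pa pb pc] := Phi_coef a b c.
have e : (fun X => phi X - Phi a b c X) = fun=> 0.
  apply: invariant_eq0; rewrite ?pa ?pb ?pc ?subrr //.
    by apply: is_form_sub => //; apply: is_form_Phi.
  by move=> A hA X; rewrite hi // Phi_invariant.
by apply: funext => X; apply/eqP; rewrite -subr_eq0; apply/eqP; have := congr1 (fun f => f X) e.
Qed.

End Classify.

(** * Metric and orientation *)

Section Real.
Variable R : realType.
Implicit Types x y r : R.

Lemma cube_inj x y : x ^+ 3 = y ^+ 3 -> x = y.
Proof.
have cube_lt (u v : R) : u < v -> u ^+ 3 < v ^+ 3.
  move=> uv; rewrite -subr_gt0.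
  (* Completing the square: u^2 + u v + v^2 = (v - u)^2 / 4 + 3 (u + v)^2 / 4. *)
  have -> : v ^+ 3 - u ^+ 3 = (v - u) ^+ 3 / 4 + 3 / 4 * (v - u) * (u + v) ^+ 2 by field.
  have d : 0 < v - u by rewrite subr_gt0.
  apply: ltr_wpDr; last by rewrite divr_gt0 ?exprn_gt0.
  by rewrite mulr_ge0 ?sqr_ge0 // mulr_ge0 ?ltW.
by move=> e; case: (ltgtP x y) => // /cube_lt; rewrite e ltxx.
Qed.

Lemma pos_root n r : (0 < n)%N -> 0 < r -> exists2 s : R, 0 < s & s ^+ n = r.
Proof.
move=> n0 r0; exists (r `^ n%:R^-1); first exact: powR_gt0.
by rewrite -powR_mulrn ?powR_ge0 // -powRrM mulVf ?powRr1 ?ltW // pnatr_eq0 -lt0n.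
Qed.

Lemma cube_root r : exists s : R, s ^+ 3 = r.
Proof.
case: (ltgtP r 0) => [r0|r0|->]; last by exists 0; rewrite expr0n.
  have [|s _ hs] := @pos_root 3 (- r) isT; first by rewrite oppr_gt0.
  by exists (- s); rewrite -[r]opprK -hs; ring.
by have [s _ hs] := @pos_root 3 r isT r0; exists s.
Qed.

Lemma cos_sin_exists x y : x ^+ 2 + y ^+ 2 = 1 -> exists alpha : R, cos alpha = x /\ sin alpha = y.
Proof.
move=> e; have x1 : -1 <= x <= 1 by apply/andP; split; nra.
have y2 : 1 - x ^+ 2 = y ^+ 2 by rewrite -e; ring.
case: (lerP 0 y) => y0.
  by exists (acos x); rewrite acosK // sin_acos // y2 sqrtr_sqr ger0_norm.
exists (- acos x); rewrite cosN sinN acosK // sin_acos // y2 sqrtr_sqr ltr0_norm //.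
by rewrite opprK.
Qed.

End Real.

Section Metric.
Variable R : realType.
Notation Phi := (Phi R). Notation e_ := (@e_ R). Notation metric_row := (@metric_row R).
Implicit Types phi : kform R 3.

Lemma ip_metric_row g1 g2 (x y : V R) : ip (diag_mx (metric_row g1 g2)) x y =
  g1 * (x 0 (inord 0) * y 0 (inord 0)) + g2 * \sum_(m <- iota 1 6) x 0 (inord m) * y 0 (inord m).
Proof.
rewrite /ip mul_mx_diag mxE (sum_ord7 _ (fun t => _)) !mxE -!val_eqE /= !inordK //=.
by rewrite !big_cons big_nil; ring.
Qed.

Lemma pos_def_metric_row g1 g2 : 0 < g1 -> 0 < g2 -> pos_def (diag_mx (metric_row g1 g2)).
Proof.
move=> g10 g20; split; first by rewrite tr_diag_mx.
move=> x; apply: contraNT; rewrite -leNgt => le0.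
have sq (t : 'I_7) : 0 <= metric_row g1 g2 0 t * (x 0 t) ^+ 2.
  by rewrite mulr_ge0 ?sqr_ge0 // mxE; case: ifP => _; apply: ltW.
have ipE : ip (diag_mx (metric_row g1 g2)) x x = \sum_t metric_row g1 g2 0 t * (x 0 t) ^+ 2.
  by rewrite /ip mul_mx_diag mxE; apply: eq_bigr => t _; rewrite !mxE; ring.
have /psumr_eq0P z : \sum_t metric_row g1 g2 0 t * (x 0 t) ^+ 2 = 0.
  by apply/eqP; rewrite eq_le -ipE le0 ipE sumr_ge0.
apply/eqP/rowP => t; rewrite mxE; have /eqP := z (fun t _ => sq t) t isT.
rewrite mulf_eq0 sqrf_eq0 => /orP[|/eqP //]; rewrite mxE.
by case: ifP => _ /eqP h; move: g10 g20; rewrite h ltxx.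
Qed.

(** Where the metric comes from: k G is diagonal with entries a^3 and six times a t^3, and k^2 = det
    G forces k^9 = det (k G) = a^9 t^18. Hence k = a t^2, and dividing by k gives G. *)
Lemma induced_Phi a b c t : a != 0 -> 0 < t -> t ^+ 3 = b ^+ 2 + c ^+ 2 ->
  Defs.induced (Phi a b c) (diag_mx (metric_row (a ^+ 2 / t ^+ 2) t)) (a * t ^+ 2).
Proof.
move=> a0 t0 tbc; have tn0 : t != 0 by rewrite gt_eqF.
split; [|split].
- by apply: pos_def_metric_row => //; apply: divr_gt0; [rewrite exprn_even_gt0 | exact: exprn_gt0].
- by rewrite /is_vol det_diag !big_ord_recl big_ord0 !mxE /=; field.
by move=> x y Z; rewrite wedge_Phi ip_metric_row /volf /metric_form -tbc; field.
Qed.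

Lemma pos_def_det (G : 'M[R]_7) : pos_def G -> \det G != 0.
Proof.
move=> [_ pG]; apply/negP => /det0P[v v0 vG].
by have := pG v v0; rewrite /ip vG mul0mx mxE ltxx.
Qed.

(* The 3-form determines c G, whose determinant is c^7 det G = c^9. *)
Lemma induced_uniq phi G c G' c' :
  Defs.induced phi G c -> Defs.induced phi G' c' -> G = G' /\ c = c'.
Proof.
move=> [pG [vG h]] [pG' [vG' h']].
have e : c *: G = c' *: G'.
  apply/matrixP => i j; rewrite !mxE.
  have ipd (H : 'M[R]_7) : ip H (delta_mx 0 i) (delta_mx 0 j) = H i j.
    by rewrite /ip -rowE mxE (bigD1 j) //= !mxE !eqxx mulr1 big1 ?addr0 // => k kj; rewrite !mxE andbC (negbTE kj) mulr0.
  have v1 d : volf d (fun t => delta_mx 0 t) = d :> R.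
    rewrite /volf -[RHS]mulr1 -(det1 R 7); congr (_ * \det _).
    by apply/matrixP => r s; rewrite !mxE eqxx /= eq_sym.
  have := h (delta_mx 0 i) (delta_mx 0 j) (fun t => delta_mx 0 t).
  by rewrite h' !ipd !v1 mulrC => ->; rewrite mulrC.
have cc : c = c'.
  (* The ninth power is undone as a cube of a cube, which is injective on all reals, so both
     orientations are covered. *)
  apply: cube_inj; apply: cube_inj; rewrite -!exprM.
  have := congr1 (fun A : 'M[R]_7 => \det A) e; rewrite !detZ -vG -vG' -!exprD.
  by [].
have c0 : c != 0.
  by apply: contra_eq_neq vG => ->; rewrite expr0n /= eq_sym; apply: pos_def_det pG.
by split=> //; move: e; rewrite -cc => /(scalerI c0).
Qed.

(** Uniqueness pins down the choice made by [xget], so its default value never occurs for a positive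
    form. *)
Lemma metric_of_uniq phi G c : Defs.induced phi G c -> metric_of phi = (G, c).
Proof.
move=> h; apply: xget_unique => [|[G' c'] h']; first exact: h.
by have [-> ->] := induced_uniq _ _ _ _ _ h h'.
Qed.

Lemma G2Lap_Phi a b c t : a != 0 -> 0 < t -> t ^+ 3 = b ^+ 2 + c ^+ 2 ->
  G2Lap (Phi a b c) = Phi (16 / 9 * (a ^+ 3 / t ^+ 4))
    (144 * (t ^+ 2 / a ^+ 2) * b) (144 * (t ^+ 2 / a ^+ 2) * c).
Proof.
move=> a0 t0 tbc; have tn0 : t != 0 by rewrite gt_eqF.
rewrite /G2Lap (metric_of_uniq _ _ _ (induced_Phi _ _ _ _ a0 t0 tbc)) /= hlap_Phi //.
  by congr Phi; field; rewrite ?a0 ?tn0.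
by rewrite mulf_neq0 ?invr_neq0 ?expf_neq0.
Qed.

Lemma posinv_Phi a b c t : a != 0 -> 0 < t -> t ^+ 3 = b ^+ 2 + c ^+ 2 -> posinv (Phi a b c).
Proof.
move=> a0 t0 tbc; split; first exact: is_form_Phi.
split; first exact: Phi_invariant.
by eexists; eexists; apply: (induced_Phi _ _ _ t).
Qed.

(** On the diagonal [metric_form] equals k g(e_i, e_i), which is nonzero. At e_0 it is a^3, so a is
    nonzero; at e_1 it is a (b^2 + c^2), so b^2 + c^2 is nonzero and, as a sum of squares, has a
    positive cube root. *)
Lemma posinvP phi : posinv phi -> exists a b c t,
  [/\ phi = Phi a b c, a != 0, 0 < t & t ^+ 3 = b ^+ 2 + c ^+ 2].
Proof.
move=> [hf [hi [G [k [pG [vG h]]]]]]; move: h; rewrite (invariant_form_Phi _ _ hf hi).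
set a := phi _; set b := phi _; set c := phi _ => h; exists a, b, c.
have k0 : k != 0.
  by apply: contra_eq_neq vG => ->; rewrite expr0n /= eq_sym; apply: pos_def_det pG.
have e0 i : (i < 7)%N -> e_ i != 0.
  by move=> i7; apply/eqP => /rowP/(_ (inord i))/eqP; rewrite mxE !mxE !eqxx oner_eq0.
have Bn0 i : (i < 7)%N -> metric_form R a b c (e_ i) (e_ i) != 0.
  move=> i7; have := h (e_ i) (e_ i) (fun t => delta_mx 0 t); rewrite wedge_Phi /volf.
  set D := \det _; have -> : D = 1.
    rewrite /D -(det1 R 7); congr (\det _).
    by apply/matrixP => r s; rewrite !mxE eqxx /= eq_sym.
  rewrite !mulr1 mulrA mulVf ?pnatr_eq0 // mul1r => ->.
  by rewrite mulf_neq0 // gt_eqF // (proj2 pG) // e0.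
have a0 : a != 0.
  by have := Bn0 0%N isT; apply: contraNneq => ->; rewrite /metric_form expr0n /= !mul0r addr0.
have bc0 : b ^+ 2 + c ^+ 2 != 0.
  have := Bn0 1%N isT; apply: contraNneq => h0.
  by rewrite /metric_form h0 mulr0 mul0r addr0 e_E // mul0r mulr0.
have [|t t0 ht] := @pos_root R 3 (b ^+ 2 + c ^+ 2) isT.
  by rewrite lt_def bc0 addr_ge0 ?sqr_ge0.
by exists t.
Qed.

End Metric.

(** * The G2-Laplacian *)

Section Bijection.
Variable R : realType.
Notation Phi := (Phi R).
Implicit Types phi psi : kform R 3.

Lemma G2Lap_positive phi : posinv phi ->
  posinv (G2Lap phi) /\ same_orientation (G2Lap phi) phi.
Proof.
move=> /posinvP[a [b [c [t [-> a0 t0 tbc]]]]]; rewrite (G2Lap_Phi R a b c t) //.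
set a1 := 16 / 9 * _; set q := 144 * _.
have a10 : a1 != 0 by rewrite mulf_neq0 ?mulf_neq0 ?invr_neq0 ?expf_neq0 ?pnatr_eq0 ?(gt_eqF t0).
have q0 : q != 0 by rewrite !mulf_neq0 ?invr_neq0 ?expf_neq0 ?pnatr_eq0 ?(gt_eqF t0).
have [|t1 t10 ht1] := @pos_root R 3 ((q * b) ^+ 2 + (q * c) ^+ 2) isT.
  have -> : (q * b) ^+ 2 + (q * c) ^+ 2 = q ^+ 2 * t ^+ 3 by rewrite tbc; ring.
  by apply: mulr_gt0; [rewrite exprn_even_gt0 | exact: exprn_gt0].
split; first exact: (posinv_Phi _ _ _ _ t1).
exists (diag_mx (metric_row R (a1 ^+ 2 / t1 ^+ 2) t1)), (a1 * t1 ^+ 2).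
exists (diag_mx (metric_row R (a ^+ 2 / t ^+ 2) t)), (a * t ^+ 2).
split; first exact: induced_Phi; split; first exact: induced_Phi.
have -> : a1 * t1 ^+ 2 * (a * t ^+ 2) = 16 / 9 * (a ^+ 4 * t1 ^+ 2 / t ^+ 2).
  by rewrite /a1; field; rewrite gt_eqF.
have [a4 s1 s2] : [/\ 0 < a ^+ 4, 0 < t1 ^+ 2 & 0 < t ^+ 2] by rewrite !exprn_even_gt0 //= ?a0 ?gt_eqF.
by rewrite mulr_gt0 ?divr_gt0 // mulr_gt0.
Qed.

(** The first coefficient of the image gives A = a^3/t^4, and the squared modulus of the other two
    gives N = t^7/a^4. Then t^5 = A^4 N^3 eliminates a, and a^3 = A t^4 recovers it. *)
Lemma G2Lap_injective phi psi : posinv phi -> posinv psi -> G2Lap phi = G2Lap psi -> phi = psi.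
Proof.
move=> /posinvP[a [b [c [t [-> a0 t0 tbc]]]]] /posinvP[a' [b' [c' [t' [-> a0' t0' tbc']]]]].
rewrite (G2Lap_Phi R a b c t) // (G2Lap_Phi R a' b' c' t') // => /Phi_inj[ea eb ec].
have tn0 : t != 0 by rewrite gt_eqF.
have tn0' : t' != 0 by rewrite gt_eqF.
have hA : a ^+ 3 / t ^+ 4 = a' ^+ 3 / t' ^+ 4 by apply: mulfI ea; rewrite mulf_neq0 ?invr_neq0 ?pnatr_eq0.
have hN : t ^+ 7 / a ^+ 4 = t' ^+ 7 / a' ^+ 4.
  have sq (u v r s w : R) : u != 0 -> w ^+ 3 = r ^+ 2 + s ^+ 2 -> 
      (144 * (w ^+ 2 / u ^+ 2) * r) ^+ 2 + (144 * (w ^+ 2 / u ^+ 2) * s) ^+ 2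
      = 144 ^+ 2 * (w ^+ 7 / u ^+ 4).
    by move=> u0 hw; rewrite !exprMn -mulrDr -hw; field.
  apply: (@mulfI _ (144 ^+ 2)); first by rewrite expf_neq0 ?pnatr_eq0.
  by rewrite -(sq a a b c t) // -(sq a' a' b' c' t') // eb ec.
(* The two quotients that determine t are read off the image. *)
have et : t = t'.
  apply: (@pexpIrn _ 5); rewrite ?nnegrE ?ltW //=.
  have q (u w : R) : u != 0 -> w != 0 -> w ^+ 5 = (u ^+ 3 / w ^+ 4) ^+ 4 * (w ^+ 7 / u ^+ 4) ^+ 3.
    by move=> u0 w0; field; rewrite u0.
  by rewrite (q a t) // (q a' t') // hA hN.
have eaa : a = a'.
  apply: cube_inj; move: hA; rewrite -et => /mulIf; apply.
  by rewrite invr_neq0 ?expf_neq0.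
move: eb ec; rewrite -et -eaa.
have q0 : 144 * (t ^+ 2 / a ^+ 2) != 0 by rewrite !mulf_neq0 ?invr_neq0 ?expf_neq0 ?pnatr_eq0.
by move=> /(mulfI q0) -> /(mulfI q0) ->.
Qed.

Lemma G2Lap_surjective psi : posinv psi -> exists phi, posinv phi /\ G2Lap phi = psi.
Proof.
move=> /posinvP[a' [b' [c' [t' [-> a0' t0' tbc']]]]].
(* The values that a^3/t^4 and t^7/a^4 must take: the target has first coefficient (16/9) A and
   squared modulus t'^3 = 144^2 N. *)
pose A := 9 / 16 * a'; pose N := t' ^+ 3 / 144 ^+ 2.
have A0 : A != 0 by rewrite !mulf_neq0 ?invr_neq0 ?pnatr_eq0.
have N0 : 0 < N by rewrite divr_gt0 ?exprn_gt0.
have [|t t0 ht] := @pos_root R 5 (A ^+ 4 * N ^+ 3) isT.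
  by apply: mulr_gt0; [rewrite exprn_even_gt0 | exact: exprn_gt0].
have tn0 : t != 0 by rewrite gt_eqF.
have [a ha] := cube_root R (A * t ^+ 4).
have a0 : a != 0.
  by apply: contra_eq_neq ha => ->; rewrite expr0n /= eq_sym mulf_neq0 ?expf_neq0.
have Na : N * a ^+ 4 = t ^+ 7.
  apply: cube_inj; have -> : (N * a ^+ 4) ^+ 3 = N ^+ 3 * (a ^+ 3) ^+ 4 by ring.
  have -> : (t ^+ 7) ^+ 3 = t ^+ 5 * t ^+ 16 by ring.
  by rewrite ha ht; ring.
(* Inverse of the factor by which the Laplacian scales b and c; scaling by q keeps the phase of the
   target. *)
pose q := a ^+ 2 / (144 * t ^+ 2).
have h : t ^+ 3 = (q * b') ^+ 2 + (q * c') ^+ 2.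
  have -> : (q * b') ^+ 2 + (q * c') ^+ 2 = q ^+ 2 * t' ^+ 3 by rewrite tbc'; ring.
  have -> : q ^+ 2 * t' ^+ 3 = N * a ^+ 4 / t ^+ 4 by rewrite /q /N; field.
  by rewrite Na; field.
exists (Phi a (q * b') (q * c')); split; first exact: (posinv_Phi _ _ _ _ t).
rewrite (G2Lap_Phi R _ _ _ t) // ha; congr Phi; rewrite /A /q; field; rewrite ?tn0 //.
Qed.

Lemma G2Lap_fixed phi : posinv phi /\ G2Lap phi = phi <->
  exists a b c, [/\ phi = Phi a b c, a ^+ 2 = 192 ^+ 2 & b ^+ 2 + c ^+ 2 = 64 ^+ 2].
Proof.
split=> [[/posinvP[a [b [c [t [-> a0 t0 tbc]]]]]]|[a [b [c [-> ha hbc]]]]].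
  have tn0 : t != 0 by rewrite gt_eqF.
  rewrite (G2Lap_Phi R a b c t) // => /Phi_inj[ea eb ec]; exists a, b, c.
  have e1 : 16 * a ^+ 2 = 9 * t ^+ 4.
    apply: (mulfI a0).
    have -> : a * (16 * a ^+ 2) = 9 * t ^+ 4 * (16 / 9 * (a ^+ 3 / t ^+ 4)) by field.
    by rewrite ea mulrC.
  have e2 : 144 * t ^+ 2 = a ^+ 2.
    (* A nonzero coefficient among b, c is needed to conclude that their common scaling factor is
       1. *)
    have bc : (b != 0) || (c != 0).
      rewrite -negb_and; apply/negP => /andP[/eqP b0 /eqP c0].
      by move: tbc; rewrite b0 c0 expr0n addr0 => /eqP; rewrite expf_eq0 (negbTE tn0).
    have k r : r != 0 -> 144 * (t ^+ 2 / a ^+ 2) * r = r -> 144 * t ^+ 2 = a ^+ 2.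
      move=> r0 e; apply: (mulIf r0); rewrite -{2}e; field; by rewrite a0.
    by case/orP: bc => r0; [apply: k r0 eb | apply: k r0 ec].
  (* Eliminating a^2 gives 9 t^4 = 16 * 144 t^2, that is t^2 = 256. *)
  have t16 : t = 16.
    apply: (@pexpIrn _ 2); rewrite ?nnegrE ?ltW //=.
    apply: (@mulfI _ (9 * t ^+ 2)); first by rewrite mulf_neq0 ?expf_neq0 ?pnatr_eq0.
    rewrite -mulrA -exprD -e1 -e2; ring.
  split=> //; first by rewrite -e2 t16; ring.
  by rewrite -tbc t16; ring.
have a0 : a != 0.
  by apply: contra_eq_neq ha => ->; rewrite expr0n /= eq_sym expf_neq0 ?pnatr_eq0.
have h : 16 ^+ 3 = b ^+ 2 + c ^+ 2 by rewrite hbc; ring.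
have t0 : 0 < 16 :> R by rewrite ltr0n.
split; first exact: (posinv_Phi _ _ _ _ 16).
rewrite (G2Lap_Phi R _ _ _ 16) // ha exprS ha.
by congr Phi; field.
Qed.

End Bijection.

Theorem theorem5p6 (R : realType) :
  (forall phi : kform R 3, posinv phi ->
     posinv (G2Lap phi) /\ same_orientation (G2Lap phi) phi) /\
  (forall phi psi : kform R 3, posinv phi -> posinv psi ->
     G2Lap phi = G2Lap psi -> phi = psi) /\
  (forall psi : kform R 3, posinv psi -> exists phi, posinv phi /\ G2Lap phi = psi) /\
  (exists! p : R * R, 0 < p.1 /\ 0 < p.2 /\
     forall phi : kform R 3,
       (posinv phi /\ G2Lap phi = phi) <->
       exists (sigma alpha : R), (sigma = 1 \/ sigma = -1) /\
         phi = (fun X => sigma ^+ 3 * p.1 ^+ 3 * e1omega X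
                         + p.2 ^+ 3 * cos alpha * VR X
                         + p.2 ^+ 3 * sin alpha * VI X)).
Proof.
split; first exact: G2Lap_positive; split; first exact: G2Lap_injective.
split; first exact: G2Lap_surjective.
have PhiF a b c : (fun X => a * e1omega X + b * VR X + c * VI X) = Phi R a b c.
  by apply: funext => X; rewrite PhiE.
have [|a0 a0_gt0 ha0] := @pos_root R 3 192 isT; first by rewrite ltr0n.
(* Fixed points have |a| = 192 = a0^3 and b^2 + c^2 = 16^3 = 64^2, so the radius is 64 = 4^3. *)
exists (a0, 4); split=> /=.
  split=> //; split; first by rewrite ltr0n.
  move=> phi; split=> [/G2Lap_fixed[a [b [c [-> ha hbc]]]]|[sigma [alpha [hs ->]]]].
    have [|alpha [hc hs]] := @cos_sin_exists R (b / 64) (c / 64).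
      by rewrite !expr_div_n -mulrDl hbc divff // expf_neq0 ?pnatr_eq0.
    exists (a / 192), alpha; split.
      by move/eqP: ha; rewrite eqf_sqr => /orP[]/eqP ->; [left|right]; field.
    refine (etrans _ (esym (PhiF _ _ _))); rewrite ha0 hc hs; congr Phi; last by field.
      (* Here sigma = a / 192 is the sign of a, and sigma^3 = sigma. *)
      have h : (a / 192) ^+ 2 = 1 by rewrite expr_div_n ha divff // expf_neq0 ?pnatr_eq0.
      by rewrite exprS h; field.
    by field.
  apply/G2Lap_fixed; do 3 eexists; split; first exact: PhiF.
    by rewrite ha0; case: hs => ->; ring.
  by rewrite !exprMn -mulrDr cos2Dsin2; ring.
move=> [p q] /= [p0 [q0 hp]].
(* One test form decides uniqueness: sigma = 1, alpha = 0 makes p^3 e1omega + q^3 VR a fixed point,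
   so (p^3)^2 = 192^2 and (q^3)^2 = 64^2, and positivity leaves one choice. *)
have /hp/G2Lap_fixed[a [b [c [/Phi_inj[<- <- <-] ha hbc]]]] : exists (sigma alpha : R),
    (sigma = 1 \/ sigma = -1) /\ Phi R (p ^+ 3) (q ^+ 3) 0 =
      fun X => sigma ^+ 3 * p ^+ 3 * e1omega X + q ^+ 3 * cos alpha * VR X + q ^+ 3 * sin alpha * VI X.
  exists 1, 0; split; first by left.
  by refine (etrans _ (esym (PhiF _ _ _))); rewrite cos0 sin0 expr1n mul1r mulr1 mulr0.
have pos_inj n (x y : R) : (0 < n)%N -> 0 < x -> 0 < y -> x ^+ n = y ^+ n -> x = y.
  by move=> n0 x0 y0; apply: pexpIrn; rewrite ?nnegrE ?ltW.
congr (_, _).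
  apply: (pos_inj 3) => //; rewrite ha0; apply/esym.
  by apply: (pos_inj 2); rewrite ?exprn_gt0 ?ltr0n.
apply: (pos_inj 3) => //.
have h : q ^+ 3 = 64 by apply: (pos_inj 2); rewrite ?exprn_gt0 ?ltr0n //; move: hbc; rewrite [0 ^+ 2]expr0n addr0.
by rewrite h; ring.
Qed.
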